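(* Let $\gamma$ satisfy $$1<\gamma<\frac{\sqrt7+1}{\sqrt7-1}\simeq 2.215,$$ and let the state $(\rho_-,u_-,e_-)$ be fixed. Then there exists a decreasing sequence of positive numbers $(\delta_n)_{n\in\mathbb{N}}$ (depending on $(\rho_-,u_-,e_-)$ and $\gamma$) such that, for all $n\in\mathbb{N}$ and for every state $(\rho_+,u_+,e_+)$ verifying: (i) $\|(\rho_+,u_+,e_+)-(\rho_-,u_-,e_-)\|\le\delta_n$, (ii) the step function equal to $(\rho_-,u_-,e_-)$ for $x<\sigma t$ and to $(\rho_+,u_+,e_+)$ for $x>\sigma t$ is a shock wave, with speed $\sigma$, for the standard Euler equations, there exists a $C^{n+2}$ traveling wave $(\rho,u,e)(x-\sigma t)$ that is a solution of the radiating gas system $$\begin{cases}\partial_t\rho+\partial_x(\rho u)=0,\\ \partial_t(\rho u)+\partial_x(\rho u^2+P)=0,\\ \partial_t(\rho E)+\partial_x(\rho E u+Pu+q)=0,\end{cases}\qquad q(t,x)=\frac12\int_{\mathbb{R}}e^{-|x-y|}\,\mathrm{sgn}(x-y)\,\theta(t,y)^4\,dy,$$ and satisfies $\lim_{\xi\to\pm\infty}(\rho,u,e)(\xi)=(\rho_\pm,u_\pm,e_\pm)$.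
   Context: Space is one-dimensional; $\mathbb{N}=\{0,1,2,\dots\}$. The gas has density $\rho>0$, velocity $u\in\mathbb{R}$, specific internal energy $e$ and specific total energy $E=e+u^2/2$. The pressure $P$ and temperature $\theta$ are given by the perfect gas law $P=R\rho\theta=(\gamma-1)\rho e$, so $\theta=(\gamma-1)e/R$, where $R>0$ is a fixed constant (the perfect gas constant) and $\gamma>1$ is the ratio of specific heats. The states satisfy $\rho_\pm>0$, $e_\pm>0$. The function $\mathrm{sgn}$ equals $1$ on $(0,\infty)$, $0$ at $0$, $-1$ on $(-\infty,0)$. The standard Euler equations are the system displayed in the claim with $q\equiv0$. A shock wave with speed $\sigma$ for the Euler equations is a step function as in (ii) that satisfies the Rankine–Hugoniot conditions: with $v_\pm=u_\pm-\sigma$, $$\rho_+v_+=\rho_-v_-,\quad \rho_+v_+^2+P_+=\rho_-v_-^2+P_-,\quad \rho_+v_+\Big(e_++\tfrac{v_+^2}{2}\Big)+P_+v_+=\rho_-v_-\Big(e_-+\tfrac{v_-^2}{2}\Big)+P_-v_-,$$ and that satisfies the Lax shock inequalities, i.e. with the sound speed $c_\pm=\sqrt{\gamma(\gamma-1)e_\pm}$, it is either a 1-shock ($u_+-c_+<\sigma<u_+$ and $\sigma<u_--c_-$) or a 3-shock ($u_-<\sigma<u_-+c_-$ and $u_++c_+<\sigma$). A $C^{k}$ traveling wave is a triple of $C^k$ functions $(\rho,u,e)$ of the single variable $\xi=x-\sigma t\in\mathbb{R}$; then $\theta$ and $q$ are also functions of $\xi$ only. *)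

(* Defs.v *)
From Stdlib Require Import Reals.
From Coquelicot Require Import Coquelicot.
Open Scope R_scope.

(** A state is a triple (density, velocity, specific internal energy).
    Coquelicot's norm on [R * R * R] is the Euclidean one. *)
Definition state : Type := (R * R * R)%type.

Definition dens (U : state) : R := fst (fst U).
Definition vel (U : state) : R := snd (fst U).
Definition ener (U : state) : R := snd U.

Definition admissible (U : state) : Prop := 0 < dens U /\ 0 < ener U.

Definition pressure (gamma rho e : R) : R := (gamma - 1) * rho * e.

(** [Rgas] is the perfect gas constant. *)
Definition temperature (Rgas gamma e : R) : R := (gamma - 1) * e / Rgas.

Definition total_energy (u e : R) : R := e + u ^ 2 / 2.

Definition sound_speed (gamma e : R) : R := sqrt (gamma * (gamma - 1) * e).

Definition rankine_hugoniot (gamma sigma : R) (Um Up : state) : Prop :=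
  let rm := dens Um in let vm := vel Um - sigma in let em := ener Um in
  let rp := dens Up in let vp := vel Up - sigma in let ep := ener Up in
  let Pm := pressure gamma rm em in
  let Pp := pressure gamma rp ep in
  rp * vp = rm * vm /\
  rp * vp ^ 2 + Pp = rm * vm ^ 2 + Pm /\
  rp * vp * (ep + vp ^ 2 / 2) + Pp * vp = rm * vm * (em + vm ^ 2 / 2) + Pm * vm.

Definition lax_1_shock (gamma sigma : R) (Um Up : state) : Prop :=
  let cm := sound_speed gamma (ener Um) in
  let cp := sound_speed gamma (ener Up) in
  vel Up - cp < sigma < vel Up /\ sigma < vel Um - cm.

Definition lax_3_shock (gamma sigma : R) (Um Up : state) : Prop :=
  let cm := sound_speed gamma (ener Um) in
  let cp := sound_speed gamma (ener Up) in
  vel Um < sigma < vel Um + cm /\ vel Up + cp < sigma.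

(** The step function equal to [Um] for [x < sigma t] and to [Up] for
    [x > sigma t] is a shock wave of speed [sigma] for the Euler equations. *)
Definition shock_wave (gamma sigma : R) (Um Up : state) : Prop :=
  rankine_hugoniot gamma sigma Um Up /\
  (lax_1_shock gamma sigma Um Up \/ lax_3_shock gamma sigma Um Up).

(** Existence of all lower derivatives is demanded explicitly, because
    [Derive] is total and [ex_derive_n f k] alone does not imply it. *)
Definition is_Ck (k : nat) (f : R -> R) : Prop :=
  forall m : nat, (m <= k)%nat ->
  forall x : R, ex_derive_n f m x /\ continuous (Derive_n f m) x.

(** The classical form of [d_t w + d_x f = 0]. *)
Definition conservation_law (w f : R -> R -> R) : Prop :=
  forall t x : R,
    ex_derive (fun s => w s x) t /\
    ex_derive (fun y => f t y) x /\
    Derive (fun s => w s x) t + Derive (fun y => f t y) x = 0.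

Definition flux_integrand (theta : R -> R) (x y : R) : R :=
  exp (- Rabs (x - y)) * sign (x - y) * theta y ^ 4.

(** The integrand has a constant sign on each side of [x], so convergence of
    this improper integral is absolute convergence. *)
Definition flux_converges (theta : R -> R) (x : R) : Prop :=
  ex_RInt_gen (flux_integrand theta x) (Rbar_locally m_infty) (Rbar_locally p_infty).

Definition radiative_flux (theta : R -> R) (x : R) : R :=
  / 2 * RInt_gen (flux_integrand theta x)
          (Rbar_locally m_infty) (Rbar_locally p_infty).

(** Functions of [t] and [x], in this order. *)
Definition radiating_gas_solution (Rgas gamma : R) (rho u e : R -> R -> R) : Prop :=
  let P t x := pressure gamma (rho t x) (e t x) in
  let E t x := total_energy (u t x) (e t x) in
  let theta t x := temperature Rgas gamma (e t x) in
  let q t x := radiative_flux (theta t) x in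
  (forall t x : R, 0 < rho t x /\ 0 < e t x) /\
  (forall t x : R, flux_converges (theta t) x) /\
  conservation_law rho (fun t x => rho t x * u t x) /\
  conservation_law (fun t x => rho t x * u t x)
                   (fun t x => rho t x * u t x ^ 2 + P t x) /\
  conservation_law (fun t x => rho t x * E t x)
                   (fun t x => rho t x * E t x * u t x + P t x * u t x + q t x).

Definition traveling (sigma : R) (f : R -> R) (t x : R) : R := f (x - sigma * t).

Definition connects (rho u e : R -> R) (Um Up : state) : Prop :=
  (is_lim rho m_infty (dens Um) /\ is_lim u m_infty (vel Um) /\
   is_lim e m_infty (ener Um)) /\
  (is_lim rho p_infty (dens Up) /\ is_lim u p_infty (vel Up) /\
   is_lim e p_infty (ener Up)).

(* Main.v *)
Require Import Defs.
From Stdlib Require Import Reals Lra Lia.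
From Coquelicot Require Import Coquelicot.
Open Scope R_scope.

(** In the frame of the shock let [v = u - sigma].  Conservation of mass and
    momentum makes [rho] and [e] functions of [v] alone, and conservation of energy
    turns the flux into [q = a (v - vm) (v - vp)] with [vm], [vp] the end values of
    [v].  The convolution that defines [q] inverts [q'' - q = (theta^4)'], so
    everything reduces to this second order equation for [v].  It degenerates at the
    sonic velocity [V = (vm + vp) / 2], where [q] as a function of [v] is critical,
    and the profile has to cross [V].

    With [z = V - v], [eps = |vm - vp| / 2] and [phi] the derivative of [theta^4 / a]
    in [z], the equation is [(z^2)'' = z^2 - eps^2 + phi(z) z'].  Near the sonic
    velocity [phi] is positive, and for a weak shock the left side is small, so
    [z'] should be close to [(eps^2 - z^2) / phi].  Writing [z' = (eps^2 - z^2) U(z)]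
    gives for [U] a singular first order equation on [0 < z < eps].  In a
    suitable time it is contracting, on the whole line, with a trapping strip;
    its bounded solution is obtained as the fixed point of a contraction
    ([contracting_bounded_solution], [one_sided_slope]).  The same is done for
    [z < 0].  The point [z = 0] is a node of the equation, hence both halves have
    the same limit there ([node_limit], [two_sided_slope]), and a quadrature gives a
    [C^1] profile that passes through [V] ([wave_profile]).

    For the smoothness, differentiate: the [k]-th derivative [h] of [z] satisfies
    [2 z h' = (phi - (2 k + 2) z') h + F] with [F] of lower order.  As long as
    [phi - (2 k + 2) z' > 0] at the sonic point, this is again a node, so that
    [h] has a limit there, determined by [F], and the same from both sides
    ([profile_smooth]).  Since [z' <= 2 eps^2 / m], where [m] bounds [phi]
    from below, the number of derivatives grows as the shock becomes weaker, which
    is why the threshold depends on [n].  The argument is made for 1-shocks;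
    3-shocks are their mirror images. *)

(** * Calculus preliminaries *)

Lemma is_derive_continuous (f : R -> R) x l : is_derive f x l -> continuous f x.
Proof. intros H; apply (ex_derive_continuous f x); exists l; exact H. Qed.

Lemma nondecreasing_of_derive (f df : R -> R) (a b : R) :
  (forall x, a <= x <= b -> is_derive f x (df x)) ->
  (forall x, a <= x <= b -> 0 <= df x) -> a <= b -> f a <= f b.
Proof.
  intros Hd Hp Hab.
  destruct (MVT_gen f a b df) as [c [Hc E]];
    rewrite ?(Rmin_left a b Hab), ?(Rmax_right a b Hab) in *.
  - intros x Hx; apply Hd; lra.
  - intros x Hx; apply continuity_pt_filterlim.
    apply (is_derive_continuous f x (df x)), Hd; lra.
  - assert (H : 0 <= df c * (b - a)) by (apply Rmult_le_pos; [apply Hp |]; lra).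
    lra.
Qed.

Lemma continuous_plus_R (f g : R -> R) x :
  continuous f x -> continuous g x -> continuous (fun y => f y + g y) x.
Proof. intros Hf Hg; exact (continuous_plus f g x Hf Hg). Qed.

Lemma continuous_opp_R (f : R -> R) x :
  continuous f x -> continuous (fun y => - f y) x.
Proof. intros Hf; exact (continuous_opp f x Hf). Qed.

Lemma continuous_minus_R (f g : R -> R) x :
  continuous f x -> continuous g x -> continuous (fun y => f y - g y) x.
Proof. intros Hf Hg; exact (continuous_minus f g x Hf Hg). Qed.

Lemma continuous_mult_R (f g : R -> R) x :
  continuous f x -> continuous g x -> continuous (fun y => f y * g y) x.
Proof. intros Hf Hg; exact (continuous_mult f g x Hf Hg). Qed.

Lemma continuous_inv_R (f : R -> R) x :
  continuous f x -> f x <> 0 -> continuous (fun y => / f y) x.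
Proof. intros Hf Hx; exact (continuous_Rinv_comp f x Hf Hx). Qed.

Ltac cont :=
  repeat first
    [ assumption
    | apply continuous_const | apply continuous_id
    | apply continuous_plus_R | apply continuous_minus_R
    | apply continuous_mult_R | apply continuous_opp_R ].

(** * Bounded solutions of contracting scalar equations *)

(** The integral of [exp (- L * (t - s)) * g s] over [s <= t]: the bounded
    solution of [y' = g - L y].  The tail over [s <= 0] is written as a limit
    along the integers, which suffices because the integrand will be nonnegative. *)
Definition damped_mean (L : R) (g : R -> R) (t : R) : R :=
  exp (- (L * t)) *
  (real (Lim_seq (fun n => RInt (fun s => exp (L * s) * g s) (- INR n) 0))
   + RInt (fun s => exp (L * s) * g s) 0 t).

Lemma damped_mean_spec (L c : R) (g : R -> R) :
  0 < L -> (forall t, continuous g t) -> (forall t, 0 <= g t <= c) ->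
  forall t, is_derive (damped_mean L g) t (g t - L * damped_mean L g t) /\
            0 <= damped_mean L g t <= c / L.
Proof.
  intros HL Hg Hb.
  set (h := fun s => exp (L * s) * g s).
  assert (Hh : forall s, continuous h s).
  { intros s; apply continuous_mult_R; [|apply Hg].
    apply (ex_derive_continuous (fun s => exp (L * s))); auto_derive; trivial. }
  assert (Hex : forall a b, ex_RInt h a b)
    by (intros; apply (ex_RInt_continuous (V := R_CompleteNormedModule)); intros; apply Hh).
  assert (Hh0 : forall s, 0 <= h s <= exp (L * s) * c).
  { intros s; pose proof (exp_pos (L * s)); pose proof (Hb s); unfold h; split.
    - apply Rmult_le_pos; lra.
    - apply Rmult_le_compat_l; lra. }
  assert (Hpos : forall a b, a <= b -> 0 <= RInt h a b).
  { intros a b Hab; apply RInt_ge_0; [exact Hab | apply Hex |].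
    intros; apply Hh0. }
  assert (Hprim : forall a b,
    is_RInt (fun s => exp (L * s) * c) a b (exp (L * b) * c / L - exp (L * a) * c / L)).
  { intros a b.
    apply (is_RInt_derive (V := R_CompleteNormedModule) (fun s => exp (L * s) * c / L)
                          (fun s => exp (L * s) * c)).
    - intros x _; auto_derive; [trivial | field; lra].
    - intros x _; apply (ex_derive_continuous (fun s => exp (L * s) * c)).
      auto_derive; trivial. }
  assert (Hc : 0 <= c) by (pose proof (Hb 0); lra).
  assert (Hup : forall a b, a <= b -> RInt h a b <= exp (L * b) * c / L).
  { intros a b Hab.
    apply Rle_trans with (exp (L * b) * c / L - exp (L * a) * c / L).
    - rewrite <- (is_RInt_unique _ _ _ _ (Hprim a b)).
      apply RInt_le; [exact Hab | apply Hex | eexists; apply Hprim |].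
      intros; apply Hh0.
    - assert (0 <= exp (L * a) * c / L); [|lra].
      apply Rdiv_le_0_compat; [|exact HL].
      apply Rmult_le_pos; [left; apply exp_pos | exact Hc]. }
  assert (Hsplit : forall a b d, RInt h a b + RInt h b d = RInt h a d)
    by (intros a b d; apply (RInt_Chasles (V := R_CompleteNormedModule) h a b d); apply Hex).
  set (w := fun n => RInt h (- INR n) 0).
  assert (Hincr : forall n, w n <= w (S n)).
  { intros n; unfold w; rewrite <- (Hsplit (- INR (S n)) (- INR n) 0).
    assert (0 <= RInt h (- INR (S n)) (- INR n)); [|lra].
    apply Hpos; rewrite S_INR; lra. }
  assert (Hlim : is_lim_seq w (real (Lim_seq w))).
  { apply Lim_seq_correct'.
    apply (ex_finite_lim_seq_incr w (exp (L * 0) * c / L) Hincr).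
    intros n; apply Hup; pose proof (pos_INR n); lra. }
  set (I := real (Lim_seq w)) in *.
  assert (Hlt : forall t, is_lim_seq (fun n => w n + RInt h 0 t) (I + RInt h 0 t)).
  { intros t; apply (is_lim_seq_plus' w (fun _ => RInt h 0 t));
      [exact Hlim | apply is_lim_seq_const]. }
  assert (Hbound : forall t, 0 <= I + RInt h 0 t <= exp (L * t) * c / L).
  { intros t; destruct (INR_unbounded (Rabs t)) as [N HN].
    assert (Hev : forall n, (N <= n)%nat -> - INR n <= t).
    { intros n Hn; apply le_INR in Hn.
      pose proof (Rle_abs (- t)); rewrite Rabs_Ropp in *; lra. }
    split.
    - apply (is_lim_seq_le_loc (fun _ => 0) (fun n => w n + RInt h 0 t) 0
               (I + RInt h 0 t)); [| apply is_lim_seq_const | apply Hlt].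
      exists N; intros n Hn; unfold w; rewrite Hsplit; apply Hpos, Hev, Hn.
    - apply (is_lim_seq_le_loc (fun n => w n + RInt h 0 t)
               (fun _ => exp (L * t) * c / L) (I + RInt h 0 t)
               (exp (L * t) * c / L)); [| apply Hlt | apply is_lim_seq_const].
      exists N; intros n Hn; unfold w; rewrite Hsplit; apply Hup, Hev, Hn. }
  assert (Hexp : forall t, exp (- (L * t)) * exp (L * t) = 1).
  { intros t; rewrite <- exp_plus, <- exp_0; f_equal; ring. }
  intros t; split.
  - assert (Hd : is_derive (fun t => RInt h 0 t) t (h t)).
    { apply is_derive_RInt with (a := 0); [|apply Hh].
      exists (mkposreal 1 Rlt_0_1); intros y _; apply RInt_correct, Hex. }
    unfold damped_mean; fold h; fold w; fold I.
    assert (Hp : is_derive (fun t => exp (- (L * t)) * (I + RInt h 0 t)) t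
      ((- L * exp (- (L * t))) * (I + RInt h 0 t) + exp (- (L * t)) * (0 + h t))).
    { apply (is_derive_mult (fun t => exp (- (L * t))) (fun t => I + RInt h 0 t)).
      - auto_derive; [trivial | ring].
      - apply (is_derive_plus (fun _ => I) (fun t => RInt h 0 t));
          [apply is_derive_Reals, derivable_pt_lim_const | exact Hd].
      - intros; apply Rmult_comm. }
    replace (g t - _) with
      ((- L * exp (- (L * t))) * (I + RInt h 0 t) + exp (- (L * t)) * (0 + h t));
      [exact Hp|].
    unfold h at 2; rewrite Rplus_0_l, <- Rmult_assoc, Hexp; ring.
  - unfold damped_mean; fold h; fold w; fold I.
    pose proof (exp_pos (- (L * t))) as He; pose proof (Hbound t) as [Hb1 Hb2].
    split; [apply Rmult_le_pos; lra |].
    replace (c / L) with (exp (- (L * t)) * (exp (L * t) * c / L));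
      [apply Rmult_le_compat_l; lra|].
    unfold Rdiv; rewrite <- !Rmult_assoc, Hexp; ring.
Qed.

(** A bounded [d] with [d' + L d <= D] on the whole line has forgotten its value
    at minus infinity: [exp (L t) (d - D / L)] is nonincreasing and vanishes there. *)
Lemma damped_bound (L B D : R) (d dd : R -> R) :
  0 < L -> (forall t, is_derive d t (dd t)) -> (forall t, d t <= B) ->
  (forall t, dd t + L * d t <= D) -> forall t, d t <= D / L.
Proof.
  intros HL Hd HB HD t.
  apply le_epsilon; intros eta Heta.
  set (K := Rabs (B - D / L)).
  assert (HK : 0 <= K) by apply Rabs_pos.
  (* at time [t - T] the initial discrepancy [K] has been damped below [eta] *)
  set (T := K / (L * eta)).
  assert (HT : 0 <= T) by (apply Rdiv_le_0_compat; [exact HK | nra]).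
  assert (Hm : exp (L * t) * (D / L - d t) >=
               exp (L * (t - T)) * (D / L - d (t - T))).
  { apply Rle_ge, (nondecreasing_of_derive
      (fun t => exp (L * t) * (D / L - d t))
      (fun t => exp (L * t) * (D - (dd t + L * d t)))); [| | lra].
    - intros x _.
      replace (exp (L * x) * (D - (dd x + L * d x))) with
        (L * exp (L * x) * (D / L - d x) + exp (L * x) * (0 - dd x))
        by (field; lra).
      apply (is_derive_mult (fun t => exp (L * t)) (fun t => D / L - d t)).
      + auto_derive; [trivial | ring].
      + apply (is_derive_minus (fun _ => D / L) d);
          [apply is_derive_Reals, derivable_pt_lim_const | apply Hd].
      + intros; apply Rmult_comm.
    - intros x _; apply Rmult_le_pos; [left; apply exp_pos|].
      pose proof (HD x); lra. }
  assert (Hs : exp (L * t) = exp (L * (t - T)) * exp (L * T))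
    by (rewrite <- exp_plus; f_equal; ring).
  rewrite Hs, Rmult_assoc in Hm; apply Rge_le, Rmult_le_reg_l in Hm;
    [|apply exp_pos].
  assert (H1 : - K <= D / L - d (t - T)).
  { pose proof (HB (t - T)); pose proof (Rle_abs (B - D / L)); fold K in H0; lra. }
  assert (H2 : 1 + L * T <= exp (L * T)) by apply exp_ineq1_le.
  assert (H3 : L * T = K / eta) by (unfold T; field; lra).
  rewrite H3 in *.
  destruct (Rle_lt_dec (d t) (D / L)) as [|Hlt]; [lra|].
  assert (H4 : (1 + K / eta) * (d t - D / L) <= K) by nra.
  assert (H5 : K / eta * eta = K) by (field; lra).
  assert (H6 : 0 <= K / eta) by (apply Rdiv_le_0_compat; lra).
  nra.
Qed.

(** A bounded solution is a fixed point of [u |-> damped_mean L (L u + F u)].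
    This map preserves the strip [k1 <= u <= k2], since the signs of [F] at [k1] and
    [k2] keep [L u + F u] between [L k1] and [L k2], and it contracts by [k / L]
    because [L u + F u] has slope at most [k] in [u]. *)
Lemma contracting_bounded_solution (F : R -> R -> R) (k1 k2 L k : R) :
  0 <= k1 <= k2 -> 0 <= k < L ->
  (forall t u w, k1 <= u -> u <= w -> w <= k2 ->
     0 <= (L * w + F t w) - (L * u + F t u) <= k * (w - u)) ->
  (forall t, 0 <= F t k1) -> (forall t, F t k2 <= 0) ->
  (forall u, (forall t, continuous u t) -> (forall t, k1 <= u t <= k2) ->
     forall t, continuous (fun t => F t (u t)) t) ->
  exists u : R -> R, forall t, k1 <= u t <= k2 /\ is_derive u t (F t (u t)).
Proof.
  intros Hk HL Hmono H1 H2 Hc.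
  set (good := fun u : R -> R =>
    (forall t, continuous u t) /\ (forall t, k1 <= u t <= k2)).
  set (g := fun (u : R -> R) t => L * u t + F t (u t)).
  set (T := fun u => damped_mean L (g u)).
  assert (Hg : forall u, good u -> forall t, continuous (g u) t).
  { intros u [Hu1 Hu2] t; unfold g; apply continuous_plus_R; [|now apply Hc].
    apply continuous_mult_R; [apply continuous_const | apply Hu1]. }
  assert (Hgb : forall u, good u -> forall t, L * k1 <= g u t <= L * k2).
  { intros u [_ Hu2] t; unfold g; specialize (Hu2 t).
    pose proof (Hmono t k1 (u t)); pose proof (Hmono t (u t) k2).
    pose proof (H1 t); pose proof (H2 t); lra. }
  assert (Hspec : forall u, good u -> forall t,
    is_derive (T u) t (g u t - L * T u t) /\ 0 <= T u t <= k2).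
  { intros u Hu t; replace k2 with (L * k2 / L) by (field; lra).
    apply damped_mean_spec; [lra | apply Hg, Hu |].
    intros s; pose proof (Hgb u Hu s).
    pose proof (Rmult_le_pos L k1); lra. }
  assert (HT : forall u, good u -> good (T u)).
  { intros u Hu; split; intros t; [|split].
    - apply (is_derive_continuous _ _ _ (proj1 (Hspec u Hu t))).
    - assert (H : - T u t <= - (L * k1) / L).
      { apply (damped_bound L 0 (- (L * k1)) (fun t => - T u t)
                 (fun t => - (g u t - L * T u t))); [lra | | |].
        - intros s; apply (is_derive_opp (T u)), Hspec, Hu.
        - intros s; pose proof (proj2 (Hspec u Hu s)); lra.
        - intros s; pose proof (Hgb u Hu s); lra. }
      replace (- (L * k1) / L) with (- k1) in H by (field; lra); lra.
    - apply Hspec, Hu. }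
  assert (Hone : forall u w D, good u -> good w ->
    (forall t, Rabs (u t - w t) <= D) -> forall t, T u t - T w t <= k / L * D).
  { intros u w D Hu Hw HD t.
    replace (k / L * D) with (k * D / L) by (field; lra).
    apply (damped_bound L k2 (k * D) (fun t => T u t - T w t)
      (fun t => (g u t - L * T u t) - (g w t - L * T w t))); [lra | | |].
    - intros s; apply (is_derive_minus (T u) (T w)); now apply Hspec.
    - intros s; pose proof (proj2 (Hspec u Hu s));
        pose proof (proj2 (Hspec w Hw s)); lra.
    - intros s; specialize (HD s).
      assert (g u s - g w s <= k * D); [|lra].
      unfold g; pose proof (proj2 Hu s); pose proof (proj2 Hw s).
      destruct (Rle_lt_dec (u s) (w s)).
      + pose proof (Hmono s (u s) (w s)).
        pose proof (Rabs_pos (u s - w s)).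
        assert (0 <= k * D) by (apply Rmult_le_pos; lra); lra.
      + pose proof (Hmono s (w s) (u s)).
        pose proof (Rle_abs (u s - w s)).
        assert (k * (u s - w s) <= k * D) by (apply Rmult_le_compat_l; lra).
        lra. }
  assert (Hcontr : forall u w D, good u -> good w ->
    (forall t, Rabs (u t - w t) <= D) ->
    forall t, Rabs (T u t - T w t) <= k / L * D).
  { intros u w D Hu Hw HD t; apply Rabs_le; split.
    - pose proof (Hone w u D Hw Hu
        (fun s => eq_ind_r (fun r => r <= D) (HD s) (Rabs_minus_sym _ _)) t); lra.
    - now apply Hone. }
  set (it := fix it (n : nat) : R -> R :=
    match n with O => fun _ => k1 | S n => T (it n) end).
  assert (Hit : forall n, good (it n)).
  { induction n as [|n IH]; [|now apply HT].
    split; intros t; [apply continuous_const | simpl; lra]. }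
  set (q := k / L).
  assert (Hq : 0 <= q < 1).
  { unfold q; split; [apply Rdiv_le_0_compat; lra|].
    apply Rlt_div_l; lra. }
  set (C := k2 - k1).
  assert (Hgeo : forall n m t, Rabs (it (n + m)%nat t - it n t) <= C * q ^ n).
  { induction n as [|n IH]; intros m t.
    - simpl; pose proof (proj2 (Hit m) t).
      apply Rabs_le; unfold C; lra.
    - replace (C * q ^ S n) with (q * (C * q ^ n)) by (simpl; ring).
      apply (Hcontr (it (n + m)%nat) (it n)); try apply Hit; apply IH. }
  assert (Hsmall : forall eta, 0 < eta -> exists N, forall n, (N <= n)%nat ->
    C * q ^ n < eta).
  { intros eta Heta.
    assert (HC : 0 <= C) by (unfold C; lra).
    destruct (pow_lt_1_zero q) with (y := eta / (C + 1)) as [N HN].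
    - rewrite Rabs_right; lra.
    - apply Rdiv_lt_0_compat; lra.
    - exists N; intros n Hn; specialize (HN n Hn).
      assert (Hp : 0 <= q ^ n) by (apply pow_le; lra).
      rewrite Rabs_right in HN by lra.
      apply Rlt_div_r in HN; [|lra]; nra. }
  set (u := fun t => real (Lim_seq (fun n => it n t))).
  assert (Hlim : forall t, is_lim_seq (fun n => it n t) (u t)).
  { intros t; apply Lim_seq_correct', ex_lim_seq_cauchy_corr.
    intros eps; destruct (Hsmall (eps / 2)) as [N HN]; [apply is_pos_div_2|].
    exists N; intros n m Hn Hm.
    replace n with (N + (n - N))%nat by lia.
    replace m with (N + (m - N))%nat by lia.
    pose proof (Hgeo N (n - N)%nat t) as G1; pose proof (Hgeo N (m - N)%nat t) as G2.
    specialize (HN N (le_n N)).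
    apply Rabs_le_between in G1; apply Rabs_le_between in G2.
    apply Rabs_def1; lra. }
  assert (Hu : forall n t, Rabs (u t - it n t) <= C * q ^ n).
  { intros n t.
    apply (is_lim_seq_le (fun m => Rabs (it (n + m)%nat t - it n t))
      (fun _ => C * q ^ n) (Rabs (u t - it n t)) (C * q ^ n));
      [intros m; apply Hgeo | | apply is_lim_seq_const].
    apply (is_lim_seq_abs (fun m => it (n + m)%nat t - it n t) (u t - it n t)).
    apply is_lim_seq_minus'; [|apply is_lim_seq_const].
    apply (is_lim_seq_ext (fun m => it (m + n)%nat t));
      [intros m; f_equal; lia |].
    exact (proj1 (is_lim_seq_incr_n (fun m => it m t) n (u t)) (Hlim t)). }
  assert (Hgood : good u).
  { split; intros t.
    - apply continuity_pt_filterlim.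
      apply (CVU_continuity it u t (mkposreal 1 Rlt_0_1)).
      + intros eta Heta; destruct (Hsmall eta Heta) as [N HN].
        exists N; intros n y Hn _; specialize (HN n Hn).
        pose proof (Hu n y); lra.
      + intros n y _; apply continuity_pt_filterlim, (Hit n).
      + unfold Boule; rewrite Rminus_diag, Rabs_R0; simpl; lra.
    - split.
      + apply (is_lim_seq_le (fun _ => k1) (fun n => it n t) k1 (u t));
          [intros n; apply (Hit n) | apply is_lim_seq_const | apply Hlim].
      + apply (is_lim_seq_le (fun n => it n t) (fun _ => k2) (u t) k2);
          [intros n; apply (Hit n) | apply Hlim | apply is_lim_seq_const]. }
  assert (Hfix : forall t, T u t = u t).
  { intros t; apply cond_eq; intros eta Heta.
    destruct (Hsmall (eta / 2)) as [N HN]; [lra|].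
    specialize (HN N (le_n N)).
    pose proof (Hcontr u (it N) (C * q ^ N) Hgood (Hit N) (Hu N) t) as B1.
    pose proof (Hu (S N) t) as B2; simpl in B2; fold q in B1.
    replace (T u t - u t) with ((T u t - T (it N) t) - (u t - T (it N) t)) by ring.
    apply Rabs_le_between in B1; apply Rabs_le_between in B2.
    assert (0 <= C * q ^ N) by
      (apply Rmult_le_pos; [unfold C; lra | apply pow_le; lra]).
    apply Rabs_def1; nra. }
  exists u; intros t; split; [apply Hgood|].
  apply (is_derive_ext (T u)); [exact Hfix|].
  replace (F t (u t)) with (g u t - L * T u t); [apply Hspec, Hgood|].
  rewrite Hfix; unfold g; ring.
Qed.

(** * The slope of the profile on one side of the sonic point *)

(** In the variable [z], the slope [z'] of the profile is [(eps^2 - z^2) * U z].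
    The equation for [U] is singular at [z = 0] and at [z = eps].  Along the
    time [r] with [dr = - dz / (2 z (eps^2 - z^2))], in which [z] is explicit and
    runs through all of [(0, eps)], it becomes a contracting equation on the whole line, with
    the trapping strip [/ (2 M) <= U <= 2 / m]. *)
Lemma one_sided_slope (eps m M : R) (phi : R -> R) :
  0 < eps -> 0 < m <= M -> eps ^ 2 <= m ^ 2 / 16 ->
  (forall z, 0 < z < eps -> continuous phi z) ->
  (forall z, 0 < z < eps -> m <= phi z <= M) ->
  exists U : R -> R, forall z, 0 < z < eps ->
    / (2 * M) <= U z <= 2 / m /\
    is_derive U z ((phi z - / U z - 2 * (eps ^ 2 - 3 * z ^ 2) * U z)
                   / (2 * z * (eps ^ 2 - z ^ 2))).
Proof.
  intros He Hm Hem Hphic Hphi.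
  set (zr := fun r => eps / sqrt (1 + exp (4 * eps ^ 2 * r))).
  assert (Hsq : forall r, 1 < sqrt (1 + exp (4 * eps ^ 2 * r))).
  { intros r; rewrite <- sqrt_1 at 1; apply sqrt_lt_1_alt.
    pose proof (exp_pos (4 * eps ^ 2 * r)); lra. }
  assert (Hzr : forall r, 0 < zr r < eps).
  { intros r; pose proof (Hsq r); unfold zr; split.
    - apply Rdiv_lt_0_compat; lra.
    - apply Rlt_div_l; nra. }
  assert (Hzrc : forall r, continuous zr r).
  { intros r; apply (ex_derive_continuous zr); unfold zr; auto_derive.
    pose proof (Hsq r); pose proof (exp_pos (4 * eps ^ 2 * r)).
    simpl in *; repeat split; lra. }
  set (F := fun r u => - phi (zr r) + / u + 2 * (eps ^ 2 - 3 * zr r ^ 2) * u).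
  assert (Hz2 : forall r, - 2 * eps ^ 2 <= eps ^ 2 - 3 * zr r ^ 2 <= eps ^ 2)
    by (intros r; pose proof (Hzr r); nra).
  assert (Hk1 : 0 < / (2 * M)) by (apply Rinv_0_lt_compat; lra).
  assert (Hk12 : / (2 * M) <= 2 / m).
  { apply Rle_trans with (/ m);
      [apply Rinv_le_contravar; lra|].
    unfold Rdiv; pose proof (Rinv_0_lt_compat m); lra. }
  assert (HmM : m ^ 2 <= M ^ 2) by (apply pow_incr; lra).
  destruct (contracting_bounded_solution F (/ (2 * M)) (2 / m)
              (4 * M ^ 2 + 4 * eps ^ 2)
              (4 * M ^ 2 + 4 * eps ^ 2 - m ^ 2 / 8)) as [u Hu].
  - lra.
  - nra.
  - intros r a b Ha Hab Hb.
    assert (Ha0 : 0 < a) by lra. assert (Hb0 : 0 < b) by lra.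
    specialize (Hz2 r); unfold F; set (c := eps ^ 2 - 3 * zr r ^ 2) in *.
    assert (Hia : / a <= 2 * M).
    { rewrite <- (Rinv_inv (2 * M)); apply Rinv_le_contravar; lra. }
    assert (Hib : m / 2 <= / b).
    { replace (m / 2) with (/ (2 / m)) by (field; lra).
      apply Rinv_le_contravar; lra. }
    assert (Hba : / b <= / a) by (apply Rinv_le_contravar; lra).
    assert (Hprod : m ^ 2 / 4 <= / a * / b <= 4 * M ^ 2) by (split; nra).
    match goal with |- _ <= ?d <= _ =>
      replace d with ((4 * M ^ 2 + 4 * eps ^ 2 - / a * / b + 2 * c) * (b - a))
        by (field; lra) end.
    split; [apply Rmult_le_pos | apply Rmult_le_compat_r]; lra.
  - intros r; pose proof (Hphi (zr r) (Hzr r)); specialize (Hz2 r).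
    unfold F; rewrite Rinv_inv.
    set (c := eps ^ 2 - 3 * zr r ^ 2) in *.
    assert (Hc : - M <= 2 * c * / (2 * M)).
    { apply Rmult_le_reg_r with M; [lra|].
      replace (2 * c * / (2 * M) * M) with c by (field; lra); nra. }
    lra.
  - intros r; pose proof (Hphi (zr r) (Hzr r)); specialize (Hz2 r).
    unfold F; set (c := eps ^ 2 - 3 * zr r ^ 2) in *.
    replace (/ (2 / m)) with (m / 2) by (field; lra).
    assert (Hc : 2 * c * (2 / m) <= m / 4).
    { apply Rmult_le_reg_r with m; [lra|].
      replace (2 * c * (2 / m) * m) with (4 * c) by (field; lra); nra. }
    lra.
  - intros w Hw Hwb r; unfold F.
    apply continuous_plus_R; [apply continuous_plus_R|].
    + apply continuous_opp_R, (continuous_comp zr phi);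
        [apply Hzrc | apply Hphic, Hzr].
    + apply continuous_inv_R; [apply Hw|]; specialize (Hwb r); lra.
    + apply continuous_mult_R; [|apply Hw].
      apply (continuous_comp zr (fun z => 2 * (eps ^ 2 - 3 * z ^ 2)));
        [apply Hzrc|].
      apply (ex_derive_continuous (fun z => 2 * (eps ^ 2 - 3 * z ^ 2))).
      auto_derive; trivial.
  - set (rz := fun z => ln ((eps ^ 2 - z ^ 2) / z ^ 2) / (4 * eps ^ 2)).
    assert (Hrz : forall z, 0 < z < eps -> zr (rz z) = z).
    { intros z Hz; unfold zr, rz.
      assert (0 < (eps ^ 2 - z ^ 2) / z ^ 2) by (apply Rdiv_lt_0_compat; nra).
      replace (4 * eps ^ 2 * _) with (ln ((eps ^ 2 - z ^ 2) / z ^ 2))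
        by (field; nra).
      rewrite exp_ln by assumption.
      replace (1 + (eps ^ 2 - z ^ 2) / z ^ 2) with ((eps / z) ^ 2)
        by (field; lra).
      rewrite sqrt_pow2; [field; lra|].
      apply Rdiv_le_0_compat; lra. }
    exists (fun z => u (rz z)); intros z Hz.
    destruct (Hu (rz z)) as [Hub Hud]; split; [exact Hub|].
    assert (Hd : is_derive rz z (- / (2 * z * (eps ^ 2 - z ^ 2)))).
    { unfold rz; auto_derive; simpl.
      - repeat split; try nra.
        apply Rdiv_lt_0_compat; nra.
      - field; repeat split; nra. }
    pose proof (is_derive_comp u rz z _ _ Hud Hd) as Hcomp.
    unfold scal in Hcomp; simpl in Hcomp; unfold mult in Hcomp; simpl in Hcomp.
    unfold F in Hcomp; rewrite (Hrz z Hz) in Hcomp.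
    match goal with |- is_derive _ _ ?l =>
      match type of Hcomp with is_derive _ _ ?l' => replace l with l' end end;
      [exact Hcomp|].
    field; repeat split; nra.
Qed.

(** * Passing through the singular point *)

(** As [z] is about [z1 x], the equation has a node at [0], which attracts backwards.
    With [E = h^2] one gets the linear inequality [x E' >= b (E - c)], with [c] of
    the order of the square of [sup |F|]; hence [x^(-b) (E - c)] is nondecreasing
    and [E] is at most about [c] near [0].  Squaring avoids a discussion of the sign
    of [h], and the argument covers an [h] not known to be bounded. *)
Lemma node_right (z A F h : R -> R) (z1 a r : R) :
  0 < z1 -> 0 < a -> 0 < r -> z 0 = 0 -> is_derive z 0 z1 ->
  (forall x, 0 < x < r -> a <= A x) ->
  (forall eta, 0 < eta -> exists d, 0 < d /\ forall x, 0 < x < d -> Rabs (F x) < eta) ->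
  (forall x, 0 < x < r -> is_derive h x ((A x * h x + F x) / (2 * z x))) ->
  forall zeta, 0 < zeta -> exists d, 0 < d /\ forall x, 0 < x < d -> Rabs (h x) < zeta.
Proof.
  intros Hz1 Ha Hr Hz0 Hz HA HF Hh zeta Hzeta.
  apply is_derive_Reals in Hz.
  destruct (Hz (z1 / 2)) as [[d1 Hd1] Hzd]; [lra|]; simpl in Hzd.
  assert (Hzx : forall x, 0 < x < d1 -> z1 / 2 * x < z x < 2 * z1 * x).
  { intros x Hx; specialize (Hzd x); rewrite Rplus_0_l, Hz0, Rminus_0_r in Hzd.
    assert (H : Rabs (z x / x - z1) < z1 / 2)
      by (apply Hzd; [lra | rewrite Rabs_right; lra]).
    apply Rabs_def2 in H; destruct H as [H1 H2].
    assert (E : z x = z x / x * x) by (field; lra).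
    rewrite E; split; apply Rmult_lt_compat_r; lra. }
  set (eta := a * zeta / 8).
  assert (Heta : 0 < eta) by (unfold eta; nra).
  destruct (HF eta Heta) as [d2 [Hd2 HFe]].
  set (x0 := Rmin r (Rmin d1 d2) / 2).
  assert (Hx0 : 0 < x0 /\ x0 < r /\ x0 < d1 /\ x0 < d2).
  { unfold x0; pose proof (Rmin_l r (Rmin d1 d2)); pose proof (Rmin_r r (Rmin d1 d2)).
    pose proof (Rmin_l d1 d2); pose proof (Rmin_r d1 d2).
    assert (0 < Rmin r (Rmin d1 d2)) by (repeat apply Rmin_glb_lt; lra); lra. }
  set (b := a / (4 * z1)); set (c := zeta ^ 2 / 8).
  assert (Hb : 0 < b) by (apply Rdiv_lt_0_compat; lra).
  assert (Hc : 0 < c) by (unfold c; nra).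
  assert (Hmon : forall x, 0 < x <= x0 ->
    exp (- b * ln x) * (h x ^ 2 - c) <= exp (- b * ln x0) * (h x0 ^ 2 - c)).
  { intros x Hx.
    apply (nondecreasing_of_derive (fun x => exp (- b * ln x) * (h x ^ 2 - c))
      (fun x => exp (- b * ln x) *
        (- b / x * (h x ^ 2 - c) + 2 * h x * ((A x * h x + F x) / (2 * z x)))));
      [| | lra].
    - intros y Hy.
      assert (Hy' : 0 < y < r) by lra.
      pose proof (Hh y Hy') as Hd; set (l := (A y * h y + F y) / (2 * z y)) in *.
      replace (exp (- b * ln y) * (- b / y * (h y ^ 2 - c) + 2 * h y * l)) with
        ((- b / y * exp (- b * ln y)) * (h y ^ 2 - c) + exp (- b * ln y) * (2 * h y * l))
        by ring.
      apply (is_derive_mult (fun x => exp (- b * ln x)) (fun x => h x ^ 2 - c)).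
      + auto_derive; [lra | field; lra].
      + auto_derive; [exists l; exact Hd |].
        replace (Derive (fun x => h x) y) with l
          by (symmetry; apply is_derive_unique; exact Hd); ring.
      + intros; apply Rmult_comm.
    - intros y Hy; apply Rmult_le_pos; [left; apply exp_pos|].
      destruct (Hzx y) as [Hzy1 Hzy2]; [lra|].
      assert (Hzy : 0 < z y) by nra.
      assert (HAy : a <= A y) by (apply HA; lra).
      assert (HFy : Rabs (F y) < eta) by (apply HFe; lra).
      (* the cross term [F h] is absorbed by Young's inequality *)
      assert (Hyoung : a / 2 * h y ^ 2 - a / 2 * (c / 4) <= h y * (A y * h y + F y)).
      { assert (F y ^ 2 <= eta ^ 2).
        { rewrite <- !Rsqr_pow2; apply Rsqr_le_abs_1.
          rewrite (Rabs_right eta); lra. }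
        assert (HE : eta ^ 2 = a ^ 2 * c / 8) by (unfold eta, c; field).
        assert (a * (F y * h y) >= - (a ^ 2 / 2) * h y ^ 2 - F y ^ 2 / 2).
        { pose proof (pow2_ge_0 (a * h y + F y)); nra. }
        assert (0 <= h y ^ 2) by apply pow2_ge_0.
        apply Rmult_le_reg_l with a; [exact Ha|].
        assert (a * (a * h y ^ 2) <= a * (A y * h y ^ 2)) by
          (apply Rmult_le_compat_l; [lra | apply Rmult_le_compat_r; lra]).
        nra. }
      replace (- b / y * (h y ^ 2 - c) + 2 * h y * ((A y * h y + F y) / (2 * z y)))
        with ((y * (h y * (A y * h y + F y)) - b * z y * (h y ^ 2 - c)) / (y * z y))
        by (field; lra).
      apply Rdiv_le_0_compat; [|nra].
      assert (Hbz : a / 8 * y <= b * z y <= a / 2 * y).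
      { unfold b; replace (a / (4 * z1) * z y) with (a / 4 * (z y / z1)) by (field; lra).
        assert (y / 2 < z y / z1 < 2 * y).
        { split; [apply (Rlt_div_r (y / 2) (z y) z1) | apply (Rlt_div_l (z y) (2 * y) z1)]; lra. }
        nra. }
      assert (0 <= h y ^ 2) by apply pow2_ge_0.
      nra. }
  (* the contribution of the value at [x0] is below [c] for [x < d] *)
  set (d := x0 * exp (- (h x0 ^ 2 / c / b))).
  assert (Hq : 0 <= h x0 ^ 2 / c) by (apply Rdiv_le_0_compat; [apply pow2_ge_0 | lra]).
  assert (Hd : 0 < d <= x0).
  { unfold d; pose proof (exp_pos (- (h x0 ^ 2 / c / b))).
    assert (exp (- (h x0 ^ 2 / c / b)) <= 1).
    { rewrite exp_Ropp, <- Rinv_1; apply Rinv_le_contravar; [lra|].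
      pose proof (exp_ineq1_le (h x0 ^ 2 / c / b)).
      assert (0 <= h x0 ^ 2 / c / b) by (apply Rdiv_le_0_compat; lra); lra. }
    nra. }
  exists d; split; [lra|]; intros x Hx.
  assert (Hxx : 0 < x <= x0) by lra.
  specialize (Hmon x Hxx).
  assert (Hln : h x0 ^ 2 / c <= b * (ln x0 - ln x)).
  { assert (H : ln x <= ln d) by (apply Rlt_le, ln_increasing; lra).
    unfold d in H; rewrite ln_mult, ln_exp in H; [|lra | apply exp_pos].
    assert (h x0 ^ 2 / c = b * (h x0 ^ 2 / c / b)) by (field; lra).
    assert (b * (h x0 ^ 2 / c / b) <= b * (ln x0 - ln x))
      by (apply Rmult_le_compat_l; lra); lra. }
  assert (Hexp : exp (- b * ln x) = exp (- b * ln x0) * exp (b * (ln x0 - ln x)))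
    by (rewrite <- exp_plus; f_equal; ring).
  rewrite Hexp, Rmult_assoc in Hmon; apply Rmult_le_reg_l in Hmon; [|apply exp_pos].
  assert (Hge : 1 + b * (ln x0 - ln x) <= exp (b * (ln x0 - ln x)))
    by apply exp_ineq1_le.
  assert (Hc0 : h x0 ^ 2 = h x0 ^ 2 / c * c) by (field; lra).
  assert (Hfin : h x ^ 2 <= 2 * c) by nra.
  rewrite <- (Rabs_right zeta) by lra.
  apply Rsqr_lt_abs_0; rewrite !Rsqr_pow2; unfold c in Hfin; nra.
Qed.

Lemma is_lim_0_spec (f : R -> R) (l : R) :
  is_lim f 0 l <->
  (forall eta, 0 < eta -> exists d, 0 < d /\
     forall x, 0 < Rabs x < d -> Rabs (f x - l) < eta).
Proof.
  rewrite <- is_lim_spec; split.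
  - intros H eta Heta; destruct (H (mkposreal eta Heta)) as [d Hd].
    exists d; split; [apply cond_pos|]; intros x Hx.
    apply Hd; [|intros E; rewrite E, Rabs_R0 in Hx; lra].
    change (Rabs (x - 0) < d); rewrite Rminus_0_r; lra.
  - intros H [eta Heta]; destruct (H eta Heta) as [d [Hd Hdx]].
    exists (mkposreal d Hd); intros x Hx Hx0; apply Hdx.
    change (Rabs (x - 0) < d) in Hx; rewrite Rminus_0_r in Hx.
    split; [now apply Rabs_pos_lt | exact Hx].
Qed.

Lemma node_limit (z A F h : R -> R) (z1 a r : R) :
  0 < z1 -> 0 < a -> 0 < r -> z 0 = 0 -> is_derive z 0 z1 ->
  (forall x, 0 < Rabs x < r -> a <= A x) -> is_lim F 0 0 ->
  (forall x, 0 < Rabs x < r -> is_derive h x ((A x * h x + F x) / (2 * z x))) ->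
  is_lim h 0 0.
Proof.
  intros Hz1 Ha Hr Hz0 Hz HA HF Hh.
  rewrite is_lim_0_spec in HF.
  assert (Hdown : forall x, 0 < x -> Rabs x = x) by (intros; apply Rabs_right; lra).
  assert (Hdown' : forall x, 0 < x -> Rabs (- x) = x)
    by (intros; rewrite Rabs_Ropp; now apply Hdown).
  assert (Hright : forall zeta, 0 < zeta ->
    exists d, 0 < d /\ forall x, 0 < x < d -> Rabs (h x) < zeta).
  { apply (node_right z A F h z1 a r); trivial.
    - intros x Hx; apply HA; rewrite Hdown; lra.
    - intros eta Heta; destruct (HF eta Heta) as [d [Hd Hdx]].
      exists d; split; [exact Hd|]; intros x Hx.
      rewrite <- (Rminus_0_r (F x)); apply Hdx; rewrite Hdown; lra.
    - intros x Hx; apply Hh; rewrite Hdown; lra. }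
  assert (Hleft : forall zeta, 0 < zeta ->
    exists d, 0 < d /\ forall x, 0 < x < d -> Rabs (h (- x)) < zeta).
  { assert (Hopp : forall x, is_derive (fun y : R => - y) x (-1))
      by (intros; auto_derive; [trivial | ring]).
    apply (node_right (fun x => - z (- x)) (fun x => A (- x)) (fun x => F (- x))
             (fun x => h (- x)) z1 a r); trivial.
    - rewrite Ropp_0, Hz0; ring.
    - replace z1 with (- (-1 * z1)) by ring.
      apply (is_derive_opp (fun x => z (- x))), (is_derive_comp z); [|apply Hopp].
      rewrite Ropp_0; exact Hz.
    - intros x Hx; apply HA; rewrite Hdown'; lra.
    - intros eta Heta; destruct (HF eta Heta) as [d [Hd Hdx]].
      exists d; split; [exact Hd|]; intros x Hx.
      rewrite <- (Rminus_0_r (F (- x))); apply Hdx; rewrite Hdown'; lra.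
    - intros x Hx.
      replace ((A (- x) * h (- x) + F (- x)) / (2 * - z (- x))) with
        (-1 * ((A (- x) * h (- x) + F (- x)) / (2 * z (- x))))
        by (unfold Rdiv; rewrite <- Ropp_mult_distr_r, Rinv_opp; ring).
      apply (is_derive_comp h); [|apply Hopp].
      apply Hh; rewrite Hdown'; lra. }
  apply is_lim_0_spec; intros zeta Hzeta.
  destruct (Hright zeta Hzeta) as [d1 [Hd1 H1]].
  destruct (Hleft zeta Hzeta) as [d2 [Hd2 H2]].
  exists (Rmin d1 d2); split; [now apply Rmin_glb_lt|]; intros x Hx.
  pose proof (Rmin_l d1 d2); pose proof (Rmin_r d1 d2); rewrite Rminus_0_r.
  destruct (Rle_lt_dec x 0) as [Hneg|Hpos].
  - rewrite Rabs_left1 in Hx by lra.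
    rewrite <- (Ropp_involutive x); apply H2; lra.
  - rewrite Rabs_right in Hx by lra; apply H1; lra.
Qed.

Lemma continuous_is_lim_0 (f : R -> R) : continuous f 0 -> is_lim f 0 (f 0).
Proof. intros H; apply is_lim_continuity, continuity_pt_filterlim, H. Qed.

Lemma node_limit_continuous (z A F h : R -> R) (z1 r : R) :
  0 < z1 -> 0 < r -> z 0 = 0 -> is_derive z 0 z1 ->
  continuous A 0 -> 0 < A 0 -> continuous F 0 ->
  (forall x, 0 < Rabs x < r -> is_derive h x ((A x * h x + F x) / (2 * z x))) ->
  is_lim h 0 (- F 0 / A 0).
Proof.
  intros Hz1 Hr Hz0 Hz HAc HA HF Hh.
  set (l := - F 0 / A 0).
  pose proof (continuous_is_lim_0 A HAc) as HAl; rewrite is_lim_0_spec in HAl.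
  destruct (HAl (A 0 / 2)) as [d [Hd HAd]]; [lra|].
  assert (Hmin : 0 < Rmin r d /\ Rmin r d <= r /\ Rmin r d <= d)
    by (split; [now apply Rmin_glb_lt | split; [apply Rmin_l | apply Rmin_r]]).
  assert (H0 : is_lim (fun x => h x - l) 0 0).
  { apply (node_limit z A (fun x => F x + A x * l) (fun x => h x - l) z1 (A 0 / 2)
             (Rmin r d)); trivial; try lra.
    - intros x Hx; assert (Hx' : 0 < Rabs x < d) by lra.
      specialize (HAd x Hx'); apply Rabs_def2 in HAd; lra.
    - replace 0 with (F 0 + A 0 * l) at 2 by (unfold l; field; lra).
      apply (continuous_is_lim_0 (fun x => F x + A x * l)); cont.
    - intros x Hx.
      replace (A x * (h x - l) + (F x + A x * l)) with (A x * h x + F x) by ring.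
      replace ((A x * h x + F x) / (2 * z x)) with
        ((A x * h x + F x) / (2 * z x) - 0) by ring.
      apply (is_derive_minus h (fun _ => l)); [apply Hh; lra|].
      apply is_derive_Reals, derivable_pt_lim_const. }
  rewrite is_lim_0_spec in *; intros eta Heta.
  destruct (H0 eta Heta) as [d' [Hd' Hx]]; exists d'; split; [exact Hd'|].
  intros x Hx'; specialize (Hx x Hx'); now rewrite Rminus_0_r in Hx.
Qed.

Lemma continuous_of_is_lim_0 (f : R -> R) : is_lim f 0 (f 0) -> continuous f 0.
Proof. intros H; apply continuity_pt_filterlim, continuity_pt_filterlim', H. Qed.

Lemma locally_gt (a x : R) : a < x -> locally x (fun y => a < y).
Proof. intros H; exact (open_gt a x H). Qed.

Lemma locally_lt (a x : R) : x < a -> locally x (fun y => y < a).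
Proof. intros H; exact (open_lt a x H). Qed.

(** Continuity at [0] is the node property for [U - U0], with [U0] the smaller root
    of [phi 0 - / U - 2 eps^2 U = 0]: linearized there, the equation has the
    coefficient [/ (U U0) - 2 eps^2], which stays positive for [U <= 2 / m]. *)
Lemma two_sided_slope (eps m M : R) (phi : R -> R) :
  0 < eps -> 0 < m <= M -> eps ^ 2 <= m ^ 2 / 16 ->
  (forall z, - eps < z < eps -> continuous phi z) ->
  (forall z, - eps < z < eps -> m <= phi z <= M) ->
  exists U : R -> R,
    (forall z, - eps < z < eps -> continuous U z /\ / (2 * M) <= U z <= 2 / m) /\
    (forall z, - eps < z < eps -> z <> 0 ->
      is_derive U z ((phi z - / U z - 2 * (eps ^ 2 - 3 * z ^ 2) * U z)
                     / (2 * z * (eps ^ 2 - z ^ 2)))).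
Proof.
  intros He Hm Hem Hphic Hphi.
  assert (Hopp : forall x, is_derive (fun y : R => - y) x (-1))
    by (intros; auto_derive; [trivial | ring]).
  destruct (one_sided_slope eps m M phi) as [Ur HUr]; trivial.
  { intros z Hz; apply Hphic; lra. }
  { intros z Hz; apply Hphi; lra. }
  destruct (one_sided_slope eps m M (fun z => phi (- z))) as [Ul HUl]; trivial.
  { intros z Hz; apply (continuous_comp (fun z => - z) phi); [cont|].
    apply Hphic; lra. }
  { intros z Hz; apply Hphi; lra. }
  set (s := sqrt (phi 0 ^ 2 - 8 * eps ^ 2)).
  set (U0 := 2 / (phi 0 + s)).
  assert (H0 : m <= phi 0 <= M) by (apply Hphi; lra).
  assert (Hpos : 0 <= phi 0 ^ 2 - 8 * eps ^ 2) by nra.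
  assert (Hs : 0 <= s) by apply sqrt_pos.
  assert (Hs2 : s ^ 2 = phi 0 ^ 2 - 8 * eps ^ 2)
    by (unfold s; rewrite <- Rsqr_pow2; now apply Rsqr_sqrt).
  assert (HsM : s <= M) by nra.
  assert (HU0 : 0 < U0) by (apply Rdiv_lt_0_compat; lra).
  assert (HU0b : / (2 * M) <= U0 <= 2 / m).
  { unfold U0, Rdiv; split.
    - apply Rle_trans with (/ M); [apply Rinv_le_contravar; lra|].
      replace (/ M) with (2 * / (2 * M)) by (field; lra).
      apply Rmult_le_compat_l; [lra | apply Rinv_le_contravar; lra].
    - apply Rmult_le_compat_l; [lra | apply Rinv_le_contravar; lra]. }
  assert (HU0eq : phi 0 = / U0 + 2 * eps ^ 2 * U0).
  { unfold U0; replace (2 * eps ^ 2) with ((phi 0 ^ 2 - s ^ 2) / 4) by lra.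
    field; lra. }
  set (U := fun z => if Rlt_dec 0 z then Ur z
                     else if Rlt_dec z 0 then Ul (- z) else U0).
  assert (HUpos : forall z, 0 < z -> U z = Ur z).
  { intros z Hz; unfold U; destruct (Rlt_dec 0 z); [reflexivity | lra]. }
  assert (HUneg : forall z, z < 0 -> U z = Ul (- z)).
  { intros z Hz; unfold U; destruct (Rlt_dec 0 z); [lra|].
    destruct (Rlt_dec z 0); [reflexivity | lra]. }
  assert (HU00 : U 0 = U0).
  { unfold U; destruct (Rlt_dec 0 0); [lra|].
    destruct (Rlt_dec 0 0); [lra | reflexivity]. }
  assert (HUb : forall z, - eps < z < eps -> / (2 * M) <= U z <= 2 / m).
  { intros z Hz; destruct (Rtotal_order z 0) as [Hn|[->|Hp]].
    - rewrite HUneg by lra; apply HUl; lra.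
    - now rewrite HU00.
    - rewrite HUpos by lra; apply HUr; lra. }
  assert (HUd : forall z, - eps < z < eps -> z <> 0 ->
    is_derive U z ((phi z - / U z - 2 * (eps ^ 2 - 3 * z ^ 2) * U z)
                   / (2 * z * (eps ^ 2 - z ^ 2)))).
  { intros z Hz Hnz; destruct (Rtotal_order z 0) as [Hn|[E|Hp]]; [| lra |].
    - apply (is_derive_ext_loc (fun z => Ul (- z))).
      { apply (filter_imp (fun y => y < 0)); [|now apply locally_lt].
        intros y Hy; symmetry; now apply HUneg. }
      rewrite HUneg by lra; assert (Hz' : 0 < - z < eps) by lra.
      pose proof (is_derive_comp Ul (fun z => - z) z _ _
                    (proj2 (HUl (- z) Hz')) (Hopp z)) as Hd.
      rewrite Ropp_involutive in Hd.
      replace (_ / (2 * z * (eps ^ 2 - z ^ 2))) with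
        (-1 * ((phi z - / Ul (- z) - 2 * (eps ^ 2 - 3 * (- z) ^ 2) * Ul (- z)) /
         (2 * - z * (eps ^ 2 - (- z) ^ 2)))); [exact Hd|].
      pose proof (proj1 (HUl (- z) Hz')).
      assert (0 < / (2 * M)) by (apply Rinv_0_lt_compat; lra).
      field; repeat split; nra.
    - apply (is_derive_ext_loc Ur).
      { apply (filter_imp (fun y => 0 < y)); [|now apply locally_gt].
        intros y Hy; symmetry; now apply HUpos. }
      rewrite HUpos by lra; apply HUr; lra. }
  exists U; split; [|exact HUd]; intros z Hz; split; [|now apply HUb].
  destruct (Req_dec z 0) as [->|Hnz];
    [|exact (is_derive_continuous _ _ _ (HUd z Hz Hnz))].
  assert (HM : 0 < / (2 * M)) by (apply Rinv_0_lt_compat; lra).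
  assert (Hlim : is_lim (fun z => U z - U0) 0 0).
  { apply (node_limit (fun z => z * (eps ^ 2 - z ^ 2))
      (fun z => / (U z * U0) - 2 * eps ^ 2)
      (fun z => (phi z - phi 0) + 6 * z ^ 2 * U z)
      (fun z => U z - U0) (eps ^ 2) (m ^ 2 / 8) eps); try nra.
    - auto_derive; [trivial | ring].
    - intros y [_ Hy]; apply Rabs_def2 in Hy.
      assert (Hyb : / (2 * M) <= U y <= 2 / m) by (apply HUb; lra).
      assert (m ^ 2 / 4 <= / (U y * U0)); [|nra].
      replace (m ^ 2 / 4) with (/ (2 / m * (2 / m))) by (field; lra).
      apply Rinv_le_contravar; [nra|]; apply Rmult_le_compat; lra.
    - apply is_lim_0_spec; intros eta Heta.
      pose proof (continuous_is_lim_0 phi (Hphic 0 ltac:(lra))) as Hp.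
      rewrite is_lim_0_spec in Hp.
      destruct (Hp (eta / 2)) as [d [Hd Hdx]]; [lra|].
      set (d' := Rmin (Rmin d eps) (Rmin 1 (m * eta / 24))).
      assert (Hd' : 0 < d' /\ d' <= d /\ d' <= eps /\ d' <= 1 /\ d' <= m * eta / 24).
      { unfold d'.
        pose proof (Rmin_l (Rmin d eps) (Rmin 1 (m * eta / 24))).
        pose proof (Rmin_r (Rmin d eps) (Rmin 1 (m * eta / 24))).
        pose proof (Rmin_l d eps); pose proof (Rmin_r d eps).
        pose proof (Rmin_l 1 (m * eta / 24)); pose proof (Rmin_r 1 (m * eta / 24)).
        split; [repeat apply Rmin_glb_lt; nra | lra]. }
      exists d'; split; [lra|]; intros y Hy.
      assert (Hyd : 0 < Rabs y < d) by lra; specialize (Hdx y Hyd).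
      assert (Hye : Rabs y < eps) by lra; apply Rabs_def2 in Hye.
      assert (Hyb : / (2 * M) <= U y <= 2 / m) by (apply HUb; lra).
      assert (Hy2 : y ^ 2 <= Rabs y) by (rewrite <- pow2_abs; nra).
      assert (Hlast : 0 <= 6 * y ^ 2 * U y < eta / 2).
      { pose proof (pow2_ge_0 y); split; [nra|].
        apply Rle_lt_trans with (6 * Rabs y * (2 / m)); [nra|].
        apply Rmult_lt_reg_r with m; [lra|].
        replace (6 * Rabs y * (2 / m) * m) with (12 * Rabs y) by (field; lra); lra. }
      apply Rabs_def2 in Hdx; apply Rabs_def1; lra.
    - intros y [Hy0 Hy]; apply Rabs_def2 in Hy.
      assert (Hny : y <> 0) by (intros ->; rewrite Rabs_R0 in Hy0; lra).
      assert (Hyb : / (2 * M) <= U y <= 2 / m) by (apply HUb; lra).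
      replace (_ / (2 * (y * (eps ^ 2 - y ^ 2)))) with
        ((phi y - / U y - 2 * (eps ^ 2 - 3 * y ^ 2) * U y)
         / (2 * y * (eps ^ 2 - y ^ 2)) - 0).
      + apply (is_derive_minus U (fun _ => U0)); [apply HUd; lra|].
        apply is_derive_Reals, derivable_pt_lim_const.
      + rewrite HU0eq; field; repeat split; nra. }
  apply continuous_of_is_lim_0; rewrite HU00.
  rewrite is_lim_0_spec in *; intros eta Heta.
  destruct (Hlim eta Heta) as [d [Hd Hdx]]; exists d; split; [exact Hd|].
  intros y Hy; specialize (Hdx y Hy); now rewrite Rminus_0_r in Hdx.
Qed.

(** * The profile as a function of position *)

(** The equation is solved by quadrature: [Y] is the inverse of a primitive [X]
    of [/ V], which is bi-Lipschitz. *)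
Lemma autonomous_ode (V : R -> R) (k K : R) :
  0 < k -> (forall y, continuous V y) -> (forall y, k <= V y <= K) ->
  exists Y : R -> R, Y 0 = 0 /\ forall x, is_derive Y x (V (Y x)).
Proof.
  intros Hk HVc HV.
  assert (HK : 0 < K) by (pose proof (HV 0); lra).
  assert (HD : forall y, / K <= / V y)
    by (intros y; pose proof (HV y); apply Rinv_le_contravar; lra).
  set (D := fun y => / V y).
  assert (HDc : forall y, continuous D y).
  { intros y; apply continuous_inv_R; [apply HVc|]; pose proof (HV y); lra. }
  set (X := fun y : R => RInt D 0 y : R).
  assert (HX : forall y, is_derive X y (/ V y)).
  { intros y; apply (is_derive_RInt D X 0 y); [|apply HDc].
    exists (mkposreal 1 Rlt_0_1); intros b _; apply (RInt_correct D 0 b).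
    apply (ex_RInt_continuous (V := R_CompleteNormedModule)); intros; apply HDc. }
  assert (HX0 : X 0 = 0) by (unfold X; apply (RInt_point (V := R_CompleteNormedModule))).
  assert (Hgrow : forall a b, a <= b -> / K * (b - a) <= X b - X a).
  { intros a b Hab.
    assert (X a - / K * a <= X b - / K * b); [|lra].
    apply (nondecreasing_of_derive (fun y => X y - / K * y) (fun y => / V y - / K));
      [| | exact Hab].
    - intros y _; apply (is_derive_minus X (fun y => / K * y)); [apply HX|].
      auto_derive; [trivial | ring].
    - intros y _; pose proof (HD y); lra. }
  assert (HK' : 0 < / K) by now apply Rinv_0_lt_compat.
  assert (Hsurj : forall x, {y | X y = x}).
  { intros x; set (b := K * Rabs x).
    assert (Hb : / K * b = Rabs x) by (unfold b; field; lra).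
    assert (Hb0 : 0 <= b) by (apply Rmult_le_pos; [lra | apply Rabs_pos]).
    assert (H1 : Rabs x <= X b) by (pose proof (Hgrow 0 b); lra).
    assert (H2 : X (- b) <= - Rabs x) by (pose proof (Hgrow (- b) 0); lra).
    destruct (IVT_gen X (- b) b x) as [y [_ Hy]].
    - intros y; apply continuity_pt_filterlim, (is_derive_continuous _ _ _ (HX y)).
    - pose proof (Rabs_pos x); rewrite Rmin_left, Rmax_right by lra.
      pose proof (Rle_abs x); pose proof (Rle_abs (- x)); rewrite Rabs_Ropp in *; lra.
    - now exists y. }
  set (Y := fun x => proj1_sig (Hsurj x)).
  assert (HXY : forall x, X (Y x) = x) by (intros x; apply (proj2_sig (Hsurj x))).
  assert (Hlip : forall a b, Rabs (Y a - Y b) <= K * Rabs (a - b)).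
  { assert (H : forall a b, Y b <= Y a -> Rabs (Y a - Y b) <= K * Rabs (a - b)).
    { intros a b Hab; pose proof (Hgrow _ _ Hab) as G; rewrite !HXY in G.
      pose proof (Rle_abs (a - b)); rewrite (Rabs_right (Y a - Y b)) by lra.
      apply Rmult_le_reg_l with (/ K); [exact HK'|].
      replace (/ K * (K * Rabs (a - b))) with (Rabs (a - b)) by (field; lra); lra. }
    intros a b; destruct (Rle_lt_dec (Y b) (Y a)); [now apply H|].
    rewrite (Rabs_minus_sym (Y a)), (Rabs_minus_sym a); apply H; lra. }
  exists Y; split.
  - destruct (Rle_lt_dec (Y 0) 0) as [H0|H0].
    + pose proof (Hgrow _ _ H0); rewrite HX0, HXY in *; nra.
    + assert (H1 : 0 <= Y 0) by lra; pose proof (Hgrow _ _ H1).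
      rewrite HX0, HXY in *; nra.
  - intros x; apply is_derive_Reals; intros eta Heta.
    pose proof (HV (Y x)) as HVx.
    pose proof (HX (Y x)) as HXd; apply is_derive_Reals in HXd.
    destruct (HXd (eta / (K * K))) as [[d Hd] Hdx];
      [apply Rdiv_lt_0_compat; nra|]; simpl in Hdx.
    assert (Hd' : 0 < d / K) by (apply Rdiv_lt_0_compat; lra).
    exists (mkposreal _ Hd'); intros h Hh Hhd; simpl in Hhd.
    set (w := Y (x + h) - Y x).
    pose proof (Hlip (x + h) x) as Hw; fold w in Hw.
    replace (x + h - x) with h in Hw by ring.
    assert (Hwd : Rabs w < d).
    { apply Rlt_div_r in Hhd; [lra|lra]. }
    assert (Hwh : X (Y x + w) - X (Y x) = h).
    { unfold w; replace (Y x + (Y (x + h) - Y x)) with (Y (x + h)) by ring.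
      rewrite !HXY; ring. }
    assert (Hw0 : w <> 0).
    { intros E; rewrite E, Rplus_0_r, Rminus_diag in Hwh; lra. }
    specialize (Hdx w Hw0 Hwd); rewrite Hwh in Hdx.
    replace (w / h - V (Y x)) with (- (V (Y x) * (w / h) * (h / w - / V (Y x))))
      by (field; lra).
    rewrite Rabs_Ropp, !Rabs_mult, (Rabs_right (V (Y x))) by lra.
    assert (Hwh' : Rabs (w / h) <= K).
    { unfold Rdiv; rewrite Rabs_mult, Rabs_inv; apply Rle_div_l;
        [now apply Rabs_pos_lt | exact Hw]. }
    pose proof (Rabs_pos (w / h)).
    pose proof (Rabs_pos (h / w - / V (Y x))).
    apply Rle_lt_trans with (K * K * Rabs (h / w - / V (Y x))).
    + apply Rmult_le_compat_r; [assumption|]; nra.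
    + apply Rlt_div_r in Hdx; nra.
Qed.

(** The profile equation [(z^2)'' = z^2 - eps^2 + phi z * z'], with the second
    derivative carried out away from the sonic point, which is placed at the
    origin.  The function [eps * (exp y - 1) / (exp y + 1)] solves
    [2 eps z_y = eps^2 - z^2] and turns [z' = (eps^2 - z^2) U z] into a regular
    equation for [y] on the whole line. *)
Lemma wave_profile (eps m M : R) (phi : R -> R) :
  0 < eps -> 0 < m <= M -> eps ^ 2 <= m ^ 2 / 16 ->
  (forall z, - eps < z < eps -> continuous phi z) ->
  (forall z, - eps < z < eps -> m <= phi z <= M) ->
  exists z p : R -> R,
    z 0 = 0 /\ (forall x, - eps < z x < eps) /\
    (forall x, is_derive z x (p x)) /\
    (forall x, continuous p x) /\ (forall x, 0 < p x <= 2 * eps ^ 2 / m) /\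
    (forall x, x <> 0 -> z x <> 0 /\
      is_derive p x ((z x ^ 2 - eps ^ 2 + phi (z x) * p x - 2 * p x ^ 2) / (2 * z x))) /\
    is_lim z m_infty (- eps) /\ is_lim z p_infty eps.
Proof.
  intros He Hm Hem Hphic Hphi.
  destruct (two_sided_slope eps m M phi) as [U [HU HUd]]; trivial.
  set (Z := fun y => eps - 2 * eps / (exp y + 1)).
  assert (HE : forall y, 0 < exp y) by apply exp_pos.
  assert (HZe : forall y, eps - Z y = 2 * eps / (exp y + 1)) by (intros; unfold Z; ring).
  assert (HZe' : forall y, eps + Z y = 2 * eps * exp y / (exp y + 1)).
  { intros y; unfold Z; pose proof (HE y); field; lra. }
  assert (HZ : forall y, - eps < Z y < eps).
  { intros y; pose proof (HE y).
    assert (0 < 2 * eps / (exp y + 1)) by (apply Rdiv_lt_0_compat; lra).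
    assert (0 < 2 * eps * exp y / (exp y + 1)) by (apply Rdiv_lt_0_compat; nra).
    pose proof (HZe y); pose proof (HZe' y); lra. }
  assert (HZd : forall y, is_derive Z y ((eps ^ 2 - Z y ^ 2) / (2 * eps))).
  { intros y; pose proof (HE y).
    replace (eps ^ 2 - Z y ^ 2) with ((eps - Z y) * (eps + Z y)) by ring.
    rewrite HZe, HZe'; unfold Z; auto_derive; [lra | field; lra]. }
  set (V := fun y => 2 * eps * U (Z y)).
  assert (HM : 0 < / (2 * M)) by (apply Rinv_0_lt_compat; lra).
  destruct (autonomous_ode V (2 * eps * / (2 * M)) (2 * eps * (2 / m)))
    as [Y [HY0 HY]].
  - nra.
  - intros y; unfold V; apply continuous_mult_R; [apply continuous_const|].
    apply (continuous_comp Z U);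
      [apply (is_derive_continuous _ _ _ (HZd y)) | apply HU, HZ].
  - intros y; pose proof (proj2 (HU (Z y) (HZ y))); unfold V; nra.
  - set (z := fun x => Z (Y x)).
    set (p := fun x => (eps ^ 2 - z x ^ 2) * U (z x)).
    assert (Hz : forall x, - eps < z x < eps) by (intros; apply HZ).
    assert (HUz : forall x, / (2 * M) <= U (z x) <= 2 / m) by (intros; apply HU, Hz).
    assert (Hz2 : forall x, 0 < eps ^ 2 - z x ^ 2 <= eps ^ 2)
      by (intros x; pose proof (Hz x); nra).
    assert (Hzd : forall x, is_derive z x (p x)).
    { intros x.
      replace (p x) with (V (Y x) * ((eps ^ 2 - z x ^ 2) / (2 * eps)))
        by (unfold V, p, z; field; lra).
      exact (is_derive_comp Z Y x _ _ (HZd (Y x)) (HY x)). }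
    assert (Hpc : forall x, continuous p x).
    { intros x; pose proof (is_derive_continuous _ _ _ (Hzd x)) as Hc.
      unfold p; apply continuous_mult_R.
      - apply (continuous_comp z (fun z => eps ^ 2 - z ^ 2)); [exact Hc|].
        apply (ex_derive_continuous (fun z => eps ^ 2 - z ^ 2)); auto_derive; trivial.
      - apply (continuous_comp z U); [exact Hc | apply HU, Hz]. }
    assert (Hp : forall x, 0 < p x <= 2 * eps ^ 2 / m).
    { intros x; specialize (HUz x); specialize (Hz2 x); unfold p; split; [nra|].
      replace (2 * eps ^ 2 / m) with (eps ^ 2 * (2 / m)) by (field; lra).
      apply Rmult_le_compat; lra. }
    assert (Hz0 : z 0 = 0) by (unfold z, Z; rewrite HY0, exp_0; field).
    assert (Hnz : forall x, x <> 0 -> z x <> 0).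
    { intros x Hx E.
      destruct (MVT_gen z 0 x p) as [c [_ Hc]].
      - intros; apply Hzd.
      - intros y _; apply continuity_pt_filterlim, (is_derive_continuous _ _ _ (Hzd y)).
      - rewrite E, Hz0, Rminus_0_r, Rminus_0_r in Hc.
        symmetry in Hc; apply Rmult_integral in Hc; pose proof (Hp c); lra. }
    set (k := eps / M).
    assert (Hk : 0 < k) by (apply Rdiv_lt_0_compat; lra).
    assert (HVk : forall y, 0 <= V y - k).
    { intros y; pose proof (proj2 (HU (Z y) (HZ y))); unfold V, k.
      replace (eps / M) with (2 * eps * / (2 * M)) by (field; lra); nra. }
    assert (HYd : forall x, is_derive (fun x => Y x - k * x) x (V (Y x) - k)).
    { intros x; apply (is_derive_minus Y (fun x => k * x)); [apply HY|].
      auto_derive; [trivial | ring]. }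
    assert (HYp : forall x, 0 <= x -> k * x <= Y x).
    { intros x Hx.
      pose proof (nondecreasing_of_derive (fun x => Y x - k * x) (fun x => V (Y x) - k)
        0 x (fun y _ => HYd y) (fun y _ => HVk (Y y)) Hx); simpl in *; lra. }
    assert (HYm : forall x, x <= 0 -> Y x <= k * x).
    { intros x Hx.
      pose proof (nondecreasing_of_derive (fun x => Y x - k * x) (fun x => V (Y x) - k)
        x 0 (fun y _ => HYd y) (fun y _ => HVk (Y y)) Hx); simpl in *; lra. }
    exists z, p.
    do 5 (split; [assumption|]); split; [intros x Hx; split; [now apply Hnz|] | split].
    + specialize (Hnz x Hx).
      pose proof (is_derive_comp U z x _ _ (HUd (z x) (Hz x) Hnz) (Hzd x)) as HUd'.
      match type of HUd' with is_derive _ _ ?l => set (dU := l) in HUd' end.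
      assert (Hd : is_derive p x ((0 - 2 * z x * p x) * U (z x) + (eps ^ 2 - z x ^ 2) * dU)).
      { apply (is_derive_mult (fun x => eps ^ 2 - z x ^ 2) (fun x => U (z x)));
          [| exact HUd' | intros; apply Rmult_comm].
        auto_derive; [exists (p x); apply Hzd |].
        replace (Derive (fun x => z x) x) with (p x)
          by (symmetry; apply is_derive_unique, Hzd); ring. }
      match goal with |- is_derive _ _ ?l =>
        match type of Hd with is_derive _ _ ?l' => replace l with l' end end;
        [exact Hd|].
      unfold dU, scal; simpl; unfold mult; simpl; unfold p.
      specialize (Hz2 x); specialize (HUz x).
      field; repeat split; lra.
    + apply is_lim_spec; intros [eta Heta]; exists (- (2 * eps / eta / k)); simpl.
      intros x Hx.
      assert (Hq : 0 < 2 * eps / eta / k)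
        by (apply Rdiv_lt_0_compat; [apply Rdiv_lt_0_compat; lra | exact Hk]).
      assert (HYx : Y x <= k * x) by (apply HYm; lra).
      assert (Hkx : k * x < - (2 * eps / eta)).
      { replace (2 * eps / eta) with (k * (2 * eps / eta / k)) by (field; lra); nra. }
      replace (z x - - eps) with (eps + Z (Y x)) by (unfold z; ring).
      rewrite HZe', Rabs_right.
      2: { pose proof (HE (Y x)); apply Rle_ge, Rdiv_le_0_compat; nra. }
      replace (2 * eps * exp (Y x) / (exp (Y x) + 1)) with (2 * eps / (exp (- Y x) + 1)).
      2: { rewrite exp_Ropp; pose proof (HE (Y x)); field; lra. }
      pose proof (exp_ineq1_le (- Y x)).
      assert (0 < 2 * eps / eta) by (apply Rdiv_lt_0_compat; lra).
      apply Rlt_div_l; [lra|].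
      replace (2 * eps) with (eta * (2 * eps / eta)) by (field; lra); nra.
    + apply is_lim_spec; intros [eta Heta]; exists (2 * eps / eta / k); simpl.
      intros x Hx.
      assert (Hq : 0 < 2 * eps / eta / k)
        by (apply Rdiv_lt_0_compat; [apply Rdiv_lt_0_compat; lra | exact Hk]).
      assert (HYx : k * x <= Y x) by (apply HYp; lra).
      assert (Hkx : 2 * eps / eta < k * x).
      { replace (2 * eps / eta) with (k * (2 * eps / eta / k)) at 1 by (field; lra); nra. }
      replace (z x - eps) with (- (eps - Z (Y x))) by (unfold z; ring).
      rewrite HZe, Rabs_Ropp, Rabs_right.
      2: { pose proof (HE (Y x)); apply Rle_ge, Rdiv_le_0_compat; nra. }
      pose proof (exp_ineq1_le (Y x)).
      assert (0 < 2 * eps / eta) by (apply Rdiv_lt_0_compat; lra).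
      apply Rlt_div_l; [lra|].
      replace (2 * eps) with (eta * (2 * eps / eta)) at 1 by (field; lra); nra.
Qed.

(** * Functions of class C^k *)

(** The recursive form of [is_Ck], suited to closure properties. *)
Fixpoint Ck (k : nat) (f : R -> R) : Prop :=
  match k with
  | O => forall x, continuous f x
  | S k => (forall x, ex_derive f x) /\ Ck k (Derive f)
  end.

Lemma Ck_ext (k : nat) (f g : R -> R) : (forall x, f x = g x) -> Ck k f -> Ck k g.
Proof.
  revert f g; induction k as [|k IH]; intros f g E; simpl.
  - intros H x; apply (continuous_ext f); [exact E | apply H].
  - intros [H1 H2]; split.
    + intros x; now apply (ex_derive_ext f).
    + apply (IH (Derive f)); [|exact H2]; intros x; now apply Derive_ext.
Qed.

Lemma Ck_S_intro (k : nat) (f df : R -> R) :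
  (forall x, is_derive f x (df x)) -> Ck k df -> Ck (S k) f.
Proof.
  intros H Hd; split; [intros x; now exists (df x)|].
  apply (Ck_ext k df); [|exact Hd].
  intros x; symmetry; apply is_derive_unique, H.
Qed.

Lemma Ck_pred (k : nat) (f : R -> R) : Ck (S k) f -> Ck k f.
Proof.
  revert f; induction k as [|k IH]; intros f [H1 H2].
  - intros x; now apply (ex_derive_continuous f).
  - split; [exact H1 | now apply IH].
Qed.

Lemma Ck_const (k : nat) (c : R) : Ck k (fun _ => c).
Proof.
  revert c; induction k as [|k IH]; intros c; [intros x; apply continuous_const|].
  apply (Ck_S_intro k _ (fun _ => 0)); [|apply IH].
  intros x; apply is_derive_Reals, derivable_pt_lim_const.
Qed.

Lemma Ck_plus (k : nat) (f g : R -> R) : Ck k f -> Ck k g -> Ck k (fun x => f x + g x).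
Proof.
  revert f g; induction k as [|k IH]; intros f g.
  - intros Hf Hg x; now apply continuous_plus_R.
  - intros [Hf Hf'] [Hg Hg'].
    apply (Ck_S_intro k _ (fun x => Derive f x + Derive g x)); [|now apply IH].
    intros x; apply (is_derive_plus f g); now apply Derive_correct.
Qed.

Lemma Ck_mult (k : nat) (f g : R -> R) : Ck k f -> Ck k g -> Ck k (fun x => f x * g x).
Proof.
  revert f g; induction k as [|k IH]; intros f g.
  - intros Hf Hg x; now apply continuous_mult_R.
  - intros HF HG; destruct (HF) as [Hf Hf'], (HG) as [Hg Hg'].
    apply (Ck_S_intro k _ (fun x => Derive f x * g x + f x * Derive g x)).
    + intros x; apply (is_derive_mult f g);
        [now apply Derive_correct | now apply Derive_correct | intros; apply Rmult_comm].
    + apply Ck_plus; apply IH; trivial; now apply Ck_pred.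
Qed.

Lemma Ck_inv (k : nat) (f : R -> R) :
  (forall x, f x <> 0) -> Ck k f -> Ck k (fun x => / f x).
Proof.
  intros Hnz; induction k as [|k IH].
  - intros Hf x; now apply continuous_inv_R.
  - intros HF; destruct (HF) as [Hf Hf'].
    apply (Ck_S_intro k _ (fun x => -1 * (Derive f x * (/ f x * / f x)))).
    + intros x.
      replace (-1 * (Derive f x * (/ f x * / f x))) with (- Derive f x / f x ^ 2)
        by (field; apply Hnz).
      apply is_derive_inv; [now apply Derive_correct | apply Hnz].
    + apply Ck_mult; [apply Ck_const|].
      assert (Ck k (fun x => / f x)) by now apply IH, Ck_pred.
      apply Ck_mult; [exact Hf' | now apply Ck_mult].
Qed.

Lemma Ck_comp_opp (k : nat) (f : R -> R) : Ck k f -> Ck k (fun x => f (- x)).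
Proof.
  revert f; induction k as [|k IH]; intros f.
  - intros Hf x; apply (continuous_comp (fun x => - x) f); [cont | apply Hf].
  - intros [Hf Hf'].
    apply (Ck_S_intro k _ (fun x => -1 * Derive f (- x))).
    + intros x; apply (is_derive_comp f (fun x => - x)); [now apply Derive_correct|].
      auto_derive; [trivial | ring].
    + apply Ck_mult; [apply Ck_const | now apply (IH (Derive f))].
Qed.

Lemma Ck_Derive_n (k j : nat) (f : R -> R) : Ck (j + k) f -> Ck k (Derive_n f j).
Proof.
  induction j as [|j IH] in k |- *; [trivial|].
  intros H; apply (IH (S k)); now replace (j + S k)%nat with (S j + k)%nat by lia.
Qed.

Lemma Ck_is_Ck (k : nat) (f : R -> R) : Ck k f -> is_Ck k f.
Proof.
  intros H m Hm x; split.
  - destruct m as [|m]; [exact I|].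
    assert (Hk : Ck (k - m) (Derive_n f m))
      by (apply Ck_Derive_n; now replace (m + (k - m))%nat with k by lia).
    replace (k - m)%nat with (S (k - S m)) in Hk by lia; apply Hk.
  - assert (Hk : Ck (k - m) (Derive_n f m))
      by (apply Ck_Derive_n; now replace (m + (k - m))%nat with k by lia).
    destruct (k - m)%nat; [apply Hk | apply (ex_derive_continuous (Derive_n f m)), Hk].
Qed.

Lemma Ck_of_Derive_n (k j : nat) (f : R -> R) :
  (forall i, (j <= i < j + k)%nat -> forall x, ex_derive (Derive_n f i) x) ->
  (forall x, continuous (Derive_n f (j + k)) x) -> Ck k (Derive_n f j).
Proof.
  induction k as [|k IH] in j |- *; intros Hd Hc.
  - rewrite Nat.add_0_r in Hc; exact Hc.
  - split; [intros x; apply Hd; lia|].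
    apply (IH (S j)).
    + intros i Hi; apply Hd; lia.
    + now replace (S j + k)%nat with (j + S k)%nat by lia.
Qed.

(** * Smoothness of the profile at the sonic point *)

(** Differential polynomials are kept as syntax because the lower order terms of the
    differentiated profile equation are produced by recursion on the number of
    derivatives, and only their order matters. *)
Inductive diffpoly : Type :=
  | Const (c : R)
  | Jet (i : nat)
  | Add (a b : diffpoly)
  | Mul (a b : diffpoly).

Fixpoint deval (h : nat -> R) (e : diffpoly) : R :=
  match e with
  | Const c => c
  | Jet i => h i
  | Add a b => deval h a + deval h b
  | Mul a b => deval h a * deval h b
  end.

Fixpoint total_derivative (e : diffpoly) : diffpoly :=
  match e with
  | Const _ => Const 0
  | Jet i => Jet (S i)
  | Add a b => Add (total_derivative a) (total_derivative b)
  | Mul a b => Add (Mul (total_derivative a) b) (Mul a (total_derivative b))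
  end.

Fixpoint order_le (k : nat) (e : diffpoly) : Prop :=
  match e with
  | Const _ => True
  | Jet i => (i <= k)%nat
  | Add a b | Mul a b => order_le k a /\ order_le k b
  end.

Lemma order_le_mono (k l : nat) (e : diffpoly) :
  (k <= l)%nat -> order_le k e -> order_le l e.
Proof. intros Hkl; induction e; simpl; intuition lia. Qed.

Lemma order_le_derivative (k : nat) (e : diffpoly) :
  order_le k e -> order_le (S k) (total_derivative e).
Proof.
  assert (Hk : (k <= S k)%nat) by lia.
  induction e; simpl; try lia; intuition (eapply order_le_mono; eauto).
Qed.

Lemma deval_ext (h h' : nat -> R) (k : nat) (e : diffpoly) :
  order_le k e -> (forall i, (i <= k)%nat -> h i = h' i) -> deval h e = deval h' e.
Proof.
  intros He Hh; induction e; simpl in *;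
    [reflexivity | now apply Hh | f_equal; intuition | f_equal; intuition].
Qed.

Lemma deval_continuous (z : R -> R) (k : nat) (e : diffpoly) (x : R) :
  order_le k e -> (forall i, (i <= k)%nat -> continuous (Derive_n z i) x) ->
  continuous (fun x => deval (fun i => Derive_n z i x) e) x.
Proof.
  intros He Hz; induction e; simpl in *.
  - apply continuous_const.
  - now apply Hz.
  - apply continuous_plus_R; intuition.
  - apply continuous_mult_R; intuition.
Qed.

Lemma deval_derive (z : R -> R) (k : nat) (e : diffpoly) (x : R) :
  order_le k e -> (forall i, (i <= k)%nat -> ex_derive (Derive_n z i) x) ->
  is_derive (fun x => deval (fun i => Derive_n z i x) e) x
            (deval (fun i => Derive_n z i x) (total_derivative e)).
Proof.
  intros He Hz; induction e as [c|i|a IHa b IHb|a IHa b IHb]; simpl in *.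
  - apply is_derive_Reals, derivable_pt_lim_const.
  - now apply (Derive_correct (Derive_n z i)), Hz.
  - apply (is_derive_plus (fun x => deval (fun i => Derive_n z i x) a)
                          (fun x => deval (fun i => Derive_n z i x) b)); intuition.
  - apply (is_derive_mult (fun x => deval (fun i => Derive_n z i x) a)
                          (fun x => deval (fun i => Derive_n z i x) b));
      [intuition | intuition | intros; apply Rmult_comm].
Qed.

(** The mean value theorem; no differentiability of [f] at [0] enters, which makes
    this the step from one more limit at the sonic point to one more derivative. *)
Lemma derivative_extends (f df : R -> R) (l : R) :
  continuous f 0 -> (forall x, x <> 0 -> is_derive f x (df x)) ->
  is_lim df 0 l -> is_derive f 0 l.
Proof.
  intros Hf Hd Hl; rewrite is_lim_0_spec in Hl.
  set (df' := fun x => if Req_dec_T x 0 then l else df x).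
  apply is_derive_Reals; intros eta Heta.
  destruct (Hl eta Heta) as [d [Hdpos Hdx]].
  exists (mkposreal d Hdpos); intros x Hx Hxd; simpl in Hxd; rewrite Rplus_0_l.
  destruct (MVT_gen f 0 x df') as [c [Hc E]].
  - intros y Hy; unfold df'; destruct (Req_dec_T y 0) as [->|Hy0]; [|now apply Hd].
    exfalso; revert Hy; unfold Rmin, Rmax; destruct (Rle_dec 0 x); lra.
  - intros y _; apply continuity_pt_filterlim.
    destruct (Req_dec_T y 0) as [->|Hy0]; [exact Hf|].
    exact (is_derive_continuous _ _ _ (Hd y Hy0)).
  - rewrite E, Rminus_0_r.
    replace (df' c * x / x - l) with (df' c - l) by (field; exact Hx).
    unfold df'; destruct (Req_dec_T c 0) as [Hc0|Hc0].
    + rewrite Rminus_diag, Rabs_R0; exact Heta.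
    + apply Hdx; split; [now apply Rabs_pos_lt|].
      apply Rle_lt_trans with (2 := Hxd); revert Hc.
      unfold Rmin, Rmax, Rabs; destruct (Rle_dec 0 x), (Rcase_abs c), (Rcase_abs x); lra.
Qed.

(** The [k]-th derivative [h_k] of the profile satisfies, for [k >= 2], the linear
    equation [2 z h_k' = A_k h_k + F_k] with [A_k = phi - (2 k + 2) z'] and [F_k] a
    differential polynomial of order [k - 1]. *)
Definition linear_coef (phi : diffpoly) (k : nat) : diffpoly :=
  Add phi (Mul (Const (- (2 * INR k + 2))) (Jet 1)).

(** [source phi j] is [F_k] for [k = j + 2]. *)
Fixpoint source (phi : diffpoly) (j : nat) : diffpoly :=
  match j with
  | O => Add (Mul (total_derivative phi) (Jet 1)) (Mul (Mul (Const 2) (Jet 0)) (Jet 1))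
  | S j => Add (Mul (total_derivative (linear_coef phi (j + 2))) (Jet (j + 2)))
               (total_derivative (source phi j))
  end.

Lemma order_linear_coef (phi : diffpoly) (k : nat) :
  order_le 0 phi -> order_le 1 (linear_coef phi k).
Proof.
  intros H; split; [apply (order_le_mono 0); [lia | exact H] | simpl; lia].
Qed.

Lemma order_source (phi : diffpoly) (j : nat) :
  order_le 0 phi -> order_le (S j) (source phi j).
Proof.
  intros H; induction j as [|j IH].
  - simpl; intuition; now apply order_le_derivative.
  - split; [split|].
    + apply (order_le_mono 2); [lia|].
      apply (order_le_derivative 1), order_linear_coef, H.
    + simpl; lia.
    + now apply (order_le_derivative (S j)).
Qed.

Section Regularity.

Variables (eps : R) (phi : diffpoly) (z p : R -> R).

Hypothesis Hphi : order_le 0 phi.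
Hypothesis Hz0 : z 0 = 0.
Hypothesis Hz : forall x, is_derive z x (p x).
Hypothesis Hpc : forall x, continuous p x.
Hypothesis Hp : forall x, x <> 0 -> z x <> 0 /\
  is_derive p x ((z x ^ 2 - eps ^ 2 + deval (fun _ => z x) phi * p x - 2 * p x ^ 2)
                 / (2 * z x)).

Let J (x : R) (i : nat) : R := Derive_n z i x.

Let J1 (x : R) : J x 1 = p x.
Proof. apply is_derive_unique, Hz. Qed.

Let phi_J (x : R) : deval (J x) phi = deval (fun _ => z x) phi.
Proof. apply (deval_ext _ _ 0 phi Hphi); intros i Hi; now replace i with O by lia. Qed.

(** Differentiating [2 z h_k' = N] gives [2 z h_(k+1)' = N' - 2 z' h_(k+1)]. *)
Lemma differentiate_once (k : nat) (N : diffpoly) :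
  order_le k N ->
  (forall x, x <> 0 -> (forall i, (i < k)%nat -> ex_derive (Derive_n z i) x) /\
     is_derive (Derive_n z k) x (deval (J x) N / (2 * z x))) ->
  forall x, x <> 0 -> (forall i, (i < S k)%nat -> ex_derive (Derive_n z i) x) /\
     is_derive (Derive_n z (S k)) x
       ((deval (J x) (total_derivative N) - 2 * p x * J x (S k)) / (2 * z x)).
Proof.
  intros HN Hk.
  assert (Hex : forall x, x <> 0 ->
    forall i, (i <= k)%nat -> ex_derive (Derive_n z i) x).
  { intros x Hx i Hi; destruct (Hk x Hx) as [H1 H2].
    destruct (Nat.eq_dec i k) as [->|Hne]; [eexists; exact H2 | apply H1; lia]. }
  intros x Hx; split; [intros i Hi; apply Hex; [exact Hx | lia]|].
  destruct (Hp x Hx) as [Hzx _].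
  apply (is_derive_ext_loc (fun y => deval (J y) N / (2 * z y))).
  - apply (filter_imp (fun y => y <> 0)); [|now apply open_neq].
    intros y Hy; symmetry; apply (is_derive_unique (Derive_n z k)), Hk, Hy.
  - assert (HJ : J x (S k) = deval (J x) N / (2 * z x))
      by (apply (is_derive_unique (Derive_n z k)), Hk, Hx).
    replace ((_ - 2 * p x * J x (S k)) / (2 * z x)) with
      ((deval (J x) (total_derivative N) * (2 * z x) - deval (J x) N * (2 * p x))
       / (2 * z x) ^ 2) by (rewrite HJ; field; exact Hzx).
    apply (is_derive_div (fun y => deval (J y) N) (fun y => 2 * z y)).
    + apply (deval_derive z k); [exact HN | now apply Hex].
    + apply (is_derive_scal z), Hz.
    + lra.
Qed.

(** The recursion starts at the second derivative because the equation for [z'] itself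
    is quadratic; differentiating it once gives the coefficient [phi - 6 z']. *)
Lemma derivative_equation (j : nat) :
  forall x, x <> 0 -> (forall i, (i < j + 2)%nat -> ex_derive (Derive_n z i) x) /\
    is_derive (Derive_n z (j + 2)) x
      ((deval (J x) (linear_coef phi (j + 2)) * J x (j + 2)%nat
        + deval (J x) (source phi j)) / (2 * z x)).
Proof.
  induction j as [|j IH]; intros x Hx.
  - set (N := Add (Mul (Add phi (Mul (Const (-2)) (Jet 1))) (Jet 1))
                  (Add (Mul (Jet 0) (Jet 0)) (Const (- eps ^ 2)))).
    destruct (differentiate_once 1 N) with (x := x) as [H1 H2]; trivial.
    + assert (order_le 1 phi) by (apply (order_le_mono 0); [lia | exact Hphi]).
      repeat split; simpl; trivial; lia.
    + intros y Hy; split.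
      * intros i Hi; replace i with O by lia; exists (p y); apply Hz.
      * apply (is_derive_ext p); [intros t; symmetry; apply J1|].
        replace (deval (J y) N) with
          (z y ^ 2 - eps ^ 2 + deval (fun _ => z y) phi * p y - 2 * p y ^ 2);
          [now apply Hp|].
        simpl; rewrite phi_J; fold (J y 1); rewrite J1.
        change (J y 0%nat) with (z y); ring.
    + split; [exact H1|].
      match type of H2 with is_derive _ _ ?l =>
        match goal with |- is_derive _ _ ?l' => replace l' with l; [exact H2|] end end.
      f_equal; cbn [N deval total_derivative linear_coef source Nat.add INR].
      rewrite <- !J1; ring.
  - destruct (differentiate_once (j + 2)
      (Add (Mul (linear_coef phi (j + 2)) (Jet (j + 2))) (source phi j)))
      with (x := x) as [H1 H2]; trivial.
    + split; [split; [|simpl; lia]|].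
      * apply (order_le_mono 1); [lia | now apply order_linear_coef].
      * apply (order_le_mono (S j)); [lia | now apply order_source].
    + split; [exact H1|].
      match type of H2 with is_derive _ _ ?l =>
        match goal with |- is_derive _ _ ?l' => replace l' with l; [exact H2|] end end.
      f_equal; cbn [deval total_derivative linear_coef source Nat.add].
      rewrite S_INR, <- !J1; ring.
Qed.

(** Each further derivative is continuous at [0] by the node property of its linear
    equation, as long as the coefficient [A_k] is positive there; this fails
    for large [k], and limits the smoothness of the profile. *)
Lemma profile_smooth (K : nat) :
  0 < p 0 -> (2 * INR K + 2) * p 0 < deval (fun _ => 0) phi -> Ck K z.
Proof.
  intros Hp0 HK.
  assert (Hall : forall k, (k <= K)%nat ->
    (forall i, (i < k)%nat -> forall x, ex_derive (Derive_n z i) x) /\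
    (forall i, (i <= k)%nat -> forall x, continuous (Derive_n z i) x)).
  { assert (Hc1 : forall i, (i <= 1)%nat -> forall x, continuous (Derive_n z i) x).
    { intros i Hi x; destruct i as [|i].
      - exact (is_derive_continuous _ _ _ (Hz x)).
      - replace i with O by lia; apply (continuous_ext p); [|apply Hpc].
        intros y; symmetry; apply J1. }
    induction k as [|[|j] IH]; intros Hk.
    - split; [lia|]; intros i Hi; apply Hc1; lia.
    - split; [|exact Hc1].
      intros i Hi x; replace i with O by lia; exists (p x); apply Hz.
    - destruct IH as [IH1 IH2]; [lia|].
      set (A := fun x => deval (J x) (linear_coef phi (j + 2))).
      set (F := fun x => deval (J x) (source phi j)).
      assert (HA0 : 0 < A 0).
      { unfold A; simpl; rewrite phi_J, J1, Hz0.
        apply le_INR in Hk; rewrite !S_INR in Hk; rewrite plus_INR; simpl; nra. }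
      assert (Hlim : is_lim (Derive_n z (j + 2)) 0 (- F 0 / A 0)).
      { apply (node_limit_continuous z A F (Derive_n z (j + 2)) (p 0) 1); trivial;
          try lra.
        - apply (deval_continuous z 1); [now apply order_linear_coef|].
          intros i Hi; now apply Hc1.
        - apply (deval_continuous z (S j)); [now apply order_source|].
          intros i Hi; now apply IH2.
        - intros x [Hx _]; apply derivative_equation.
          intros ->; rewrite Rabs_R0 in Hx; lra. }
      replace (j + 2)%nat with (S (S j)) in Hlim by lia.
      set (l := - F 0 / A 0) in *.
      assert (Hoff : forall x, x <> 0 ->
        forall i, (i <= S (S j))%nat -> ex_derive (Derive_n z i) x).
      { intros x Hx i Hi; destruct (derivative_equation j x Hx) as [H1 H2].
        replace (j + 2)%nat with (S (S j)) in * by lia.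
        destruct (Nat.eq_dec i (S (S j))) as [->|Hne];
          [eexists; exact H2 | apply H1; lia]. }
      assert (Hd0 : is_derive (Derive_n z (S j)) 0 l).
      { apply (derivative_extends _ (Derive_n z (S (S j)))); [now apply IH2| |exact Hlim].
        intros x Hx; apply (Derive_correct (Derive_n z (S j))), Hoff; [exact Hx | lia]. }
      split.
      + intros i Hi x; destruct (Nat.eq_dec i (S j)) as [->|Hne]; [|apply IH1; lia].
        destruct (Req_dec x 0) as [->|Hx]; [now exists l | apply Hoff; [exact Hx | lia]].
      + intros i Hi x; destruct (Nat.eq_dec i (S (S j))) as [->|Hne]; [|apply IH2; lia].
        destruct (Req_dec x 0) as [->|Hx];
          [|apply (ex_derive_continuous (Derive_n z (S (S j)))), Hoff; [exact Hx | lia]].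
        apply continuous_of_is_lim_0.
        now replace (Derive_n z (S (S j)) 0) with l
          by (symmetry; apply (is_derive_unique (Derive_n z (S j))), Hd0). }
  destruct (Hall K (le_n K)) as [H1 H2].
  apply (Ck_of_Derive_n K 0 z).
  - intros i Hi; apply H1; lia.
  - now apply H2.
Qed.

End Regularity.

(** * The radiative flux *)

Lemma exp_weight_vanishes (h : R -> R) (B x : R) :
  (forall y, Rabs (h y) <= B) -> is_lim (fun y => exp (y - x) * h y) m_infty 0.
Proof.
  intros HB; apply is_lim_spec; intros [eta Heta].
  assert (HB0 : 0 <= B) by (apply Rle_trans with (2 := HB 0), Rabs_pos).
  assert (He : 0 < eta / (B + 1)) by (apply Rdiv_lt_0_compat; lra).
  exists (x + ln (eta / (B + 1))); intros y Hy; simpl.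
  assert (Hlt : exp (y - x) < eta / (B + 1)).
  { rewrite <- (exp_ln (eta / (B + 1))) by exact He; apply exp_increasing; lra. }
  apply Rlt_div_r in Hlt; [|lra].
  rewrite Rminus_0_r, Rabs_mult, Rabs_right by (left; apply exp_pos).
  pose proof (exp_pos (y - x)); pose proof (HB y); nra.
Qed.

Lemma is_RInt_gen_left (H dH f : R -> R) (x : R) :
  (forall y, is_derive H y (dH y)) -> (forall y, continuous dH y) ->
  (forall y, y < x -> f y = dH y) -> is_lim H m_infty 0 ->
  is_RInt_gen f (Rbar_locally m_infty) (at_point x) (H x).
Proof.
  intros Hd Hc Hf Hl.
  assert (HD : forall y, Derive H y = dH y) by (intros; now apply is_derive_unique).
  apply (is_RInt_gen_ext (Derive H)).
  - exists (fun a => a < x) (fun b => b = x); [now exists x | reflexivity |].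
    intros a b Ha -> y; simpl; unfold Rmin, Rmax; destruct (Rle_dec a x); [|lra].
    intros Hy; rewrite HD, Hf; [reflexivity | lra].
  - replace (H x) with (H x - 0) by ring.
    apply is_RInt_gen_Derive; try apply filter_forall; try exact Hl.
    + intros _ y _; exists (dH y); apply Hd.
    + intros _ y _; apply (continuous_ext dH); [intros; now rewrite HD | apply Hc].
    + intros P HP; exact (locally_singleton _ _ HP).
Qed.

(** Two integrations by parts are hidden in the antiderivatives
    [exp (y - x) (q - w)] and [- exp (x - y) (q + w)] of the integrand
    on the two sides of [x]. *)
Lemma radiative_flux_of_balance (theta q w : R -> R) (B : R) :
  (forall y, is_derive w y (q y)) ->
  (forall y, is_derive q y (w y + theta y ^ 4)) ->
  (forall y, continuous theta y) ->
  (forall y, Rabs (q y) <= B) -> (forall y, Rabs (w y) <= B) ->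
  forall x, flux_converges theta x /\ radiative_flux theta x = q x.
Proof.
  intros Hw Hq Ht HqB HwB x.
  assert (Ht4 : forall y, continuous (fun y => theta y ^ 4) y).
  { intros y; apply (continuous_comp theta (fun s => s ^ 4)); [apply Ht|].
    apply (ex_derive_continuous (fun s => s ^ 4)); auto_derive; trivial. }
  assert (Hexp : forall c d y, continuous (fun y => exp (c * y + d)) y).
  { intros c d y; apply (ex_derive_continuous (fun y => exp (c * y + d))).
    auto_derive; trivial. }
  assert (Hdw : forall y, Derive (fun y => w y) y = q y)
    by (intros; apply is_derive_unique, Hw).
  assert (Hdq : forall y, Derive (fun y => q y) y = w y + theta y ^ 4)
    by (intros; apply is_derive_unique, Hq).
  assert (Hleft : is_RInt_gen (flux_integrand theta x) (Rbar_locally m_infty)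
                    (at_point x) (q x - w x)).
  { replace (q x - w x) with (exp (x - x) * (q x - w x))
      by (rewrite Rminus_diag, exp_0; ring).
    apply (is_RInt_gen_left (fun y => exp (y - x) * (q y - w y))
             (fun y => exp (y - x) * theta y ^ 4)).
    - intros y; auto_derive;
        [repeat split; [exists (w y + theta y ^ 4) | exists (q y)]; auto |].
      rewrite Hdw, Hdq; unfold Rminus; ring.
    - intros y; apply continuous_mult_R; [|apply Ht4].
      apply (continuous_ext (fun y => exp (1 * y + - x)));
        [intros; f_equal; ring | apply Hexp].
    - intros y Hy; unfold flux_integrand; rewrite Rabs_right, sign_eq_1 by lra.
      replace (- (x - y)) with (y - x) by ring; ring.
    - apply exp_weight_vanishes with (B := B + B); intros y.
      apply Rle_trans with (1 := Rabs_triang _ _); rewrite Rabs_Ropp.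
      pose proof (HqB y); pose proof (HwB y); lra. }
  assert (Hright : is_RInt_gen (flux_integrand theta x) (at_point x)
                    (Rbar_locally p_infty) (q x + w x)).
  { set (H := fun y => - (exp (x - y) * (q y + w y))).
    set (dH := fun y => - (exp (x - y) * theta y ^ 4)).
    assert (HH : forall y, is_derive H y (dH y)).
    { intros y; unfold H, dH; auto_derive;
        [repeat split; [exists (w y + theta y ^ 4) | exists (q y)]; auto |].
      rewrite Hdw, Hdq; unfold Rminus; ring. }
    assert (HD : forall y, Derive H y = dH y) by (intros; now apply is_derive_unique).
    apply (is_RInt_gen_ext (Derive H)).
    - exists (fun a => a = x) (fun b => x < b); [reflexivity | now exists x |].
      intros a b -> Hb y; simpl; unfold Rmin, Rmax; destruct (Rle_dec x b); [|lra].
      intros Hy; rewrite HD; unfold dH, flux_integrand.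
      rewrite Rabs_left, sign_eq_m1 by lra.
      replace (- - (x - y)) with (x - y) by ring; ring.
    - replace (q x + w x) with (0 - H x)
        by (unfold H; rewrite Rminus_diag, exp_0; ring).
      apply is_RInt_gen_Derive; try apply filter_forall.
      + intros _ y _; exists (dH y); apply HH.
      + intros _ y _; apply (continuous_ext dH); [intros; now rewrite HD |].
        unfold dH; apply continuous_opp_R, continuous_mult_R; [|apply Ht4].
        apply (continuous_ext (fun y => exp (-1 * y + x)));
          [intros; f_equal; ring | apply Hexp].
      + intros P HP; exact (locally_singleton _ _ HP).
      + change (is_lim H p_infty 0).
        set (k := fun y => exp (y - - x) * - (q (- y) + w (- y))).
        apply (is_lim_ext (fun y => k (- y))).
        { intros y; unfold k, H; rewrite Ropp_involutive.
          replace (- y - - x) with (x - y) by ring; ring. }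
        apply (is_lim_comp k (fun y => - y) p_infty 0 m_infty).
        * apply exp_weight_vanishes with (B := B + B); intros y.
          rewrite Rabs_Ropp; apply Rle_trans with (1 := Rabs_triang _ _).
          pose proof (HqB (- y)); pose proof (HwB (- y)); lra.
        * apply (is_lim_opp (fun y => y) p_infty p_infty), is_lim_id.
        * exists 0; intros; discriminate. }
  pose proof (is_RInt_gen_Chasles _ x _ _ Hleft Hright) as Hall.
  split; [eexists; exact Hall|].
  unfold radiative_flux; rewrite (is_RInt_gen_unique _ _ Hall).
  change (/ 2 * ((q x - w x) + (q x + w x)) = q x); field.
Qed.

(** * From the velocity profile to the traveling wave *)

Lemma traveling_conservation (sigma c : R) (W : R -> R) (f : R -> R -> R) :
  (forall s, ex_derive W s) ->
  (forall t x, f t x = sigma * W (x - sigma * t) + c) ->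
  conservation_law (fun t x => W (x - sigma * t)) f.
Proof.
  intros HW Hf t x.
  set (D := Derive W (x - sigma * t)).
  assert (HD : is_derive W (x - sigma * t) D) by apply Derive_correct, HW.
  assert (Ht : is_derive (fun s => W (x - sigma * s)) t (- sigma * D)).
  { apply (is_derive_comp W (fun s => x - sigma * s)); [exact HD|].
    auto_derive; [trivial | ring]. }
  assert (Hx : is_derive (fun y => f t y) x (sigma * D)).
  { apply (is_derive_ext (fun y => sigma * W (y - sigma * t) + c));
      [intros; symmetry; apply Hf|].
    replace (sigma * D) with (sigma * (1 * D) + 0) by ring.
    apply (is_derive_plus (fun y => sigma * W (y - sigma * t)) (fun _ => c));
      [|apply is_derive_Reals, derivable_pt_lim_const].
    apply (is_derive_scal (fun y => W (y - sigma * t))).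
    apply (is_derive_comp W (fun y => y - sigma * t)); [exact HD|].
    auto_derive; [trivial | ring]. }
  split; [eexists; exact Ht | split; [eexists; exact Hx|]].
  transitivity (- sigma * D + sigma * D); [|ring].
  f_equal; apply is_derive_unique; assumption.
Qed.

(** Dividing the momentum and energy fluxes by the common mass flux leaves
    [v + (gamma - 1) e / v], whose common value is [C], and [gamma e + v^2 / 2].
    Eliminating [e] from the second, its difference between the two states is a
    multiple of [vp - vm], and the cofactor gives the sum of the velocities. *)
Lemma rankine_hugoniot_relative (gamma sigma : R) (Um Up : state) :
  0 < dens Um -> rankine_hugoniot gamma sigma Um Up ->
  let vm := vel Um - sigma in let vp := vel Up - sigma in
  vm <> 0 -> vp <> 0 -> vp <> vm ->
  exists C,
    dens Up * vp = dens Um * vm /\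
    (gamma - 1) * ener Um = vm * (C - vm) /\
    (gamma - 1) * ener Up = vp * (C - vp) /\
    (gamma + 1) * (vm + vp) = 2 * gamma * C.
Proof.
  intros Hr (H1 & H2 & H3) vm vp Hvm Hvp Hne; unfold pressure in *.
  fold vm vp in H1, H2, H3.
  exists (vm + (gamma - 1) * ener Um / vm).
  set (j := dens Um * vm) in *.
  assert (Hj : j <> 0) by (apply Rmult_integral_contrapositive; lra).
  assert (Hrp : dens Up = j / vp) by (rewrite <- H1; field; exact Hvp).
  assert (Hrm : dens Um = j / vm) by (unfold j; field; exact Hvm).
  rewrite Hrp, Hrm in H2, H3.
  assert (E2 : vp + (gamma - 1) * ener Up / vp = vm + (gamma - 1) * ener Um / vm).
  { apply (Rmult_eq_reg_l j); [|exact Hj].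
    transitivity (j / vp * vp ^ 2 + (gamma - 1) * (j / vp) * ener Up); [field; exact Hvp|].
    rewrite H2; field; exact Hvm. }
  assert (E3 : gamma * ener Up + vp ^ 2 / 2 = gamma * ener Um + vm ^ 2 / 2).
  { apply (Rmult_eq_reg_l j); [|exact Hj].
    transitivity (j / vp * vp * (ener Up + vp ^ 2 / 2) +
                  (gamma - 1) * (j / vp) * ener Up * vp); [field; exact Hvp|].
    rewrite H3; field; exact Hvm. }
  set (C := vm + (gamma - 1) * ener Um / vm) in *.
  assert (Em : (gamma - 1) * ener Um = vm * (C - vm)) by (unfold C; field; exact Hvm).
  assert (Ep : (gamma - 1) * ener Up = vp * (C - vp)) by (rewrite <- E2; field; exact Hvp).
  repeat split; trivial.
  apply (Rmult_eq_reg_l (vp - vm)); [|lra].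
  assert (E4 : (gamma - 1) * (gamma * ener Up + vp ^ 2 / 2) =
               (gamma - 1) * (gamma * ener Um + vm ^ 2 / 2)) by now rewrite E3.
  assert (E5 : gamma * (vp * (C - vp)) + (gamma - 1) * vp ^ 2 / 2 =
               gamma * (vm * (C - vm)) + (gamma - 1) * vm ^ 2 / 2)
    by (rewrite <- Em, <- Ep; lra).
  lra.
Qed.

(** Mass and momentum conservation express the density and the energy through the
    relative velocity [v], and energy conservation makes the radiative flux a
    quadratic function of [v] that vanishes at both end states. *)
Lemma traveling_wave_of_velocity
  (Rgas gamma sigma C B : R) (k : nat) (Um Up : state) (v w : R -> R) :
  let vm := vel Um - sigma in let vp := vel Up - sigma in
  let j := dens Um * vm in
  let q := fun x => j * (gamma + 1) / (2 * (gamma - 1)) * ((v x - vm) * (v x - vp)) in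
  let theta := fun x => v x * (C - v x) / Rgas in
  0 < Rgas -> 1 < gamma -> vm <> 0 -> vp <> 0 ->
  dens Up * vp = dens Um * vm ->
  (gamma - 1) * ener Um = vm * (C - vm) ->
  (gamma - 1) * ener Up = vp * (C - vp) ->
  (gamma + 1) * (vm + vp) = 2 * gamma * C ->
  Ck (S k) v -> (forall x, 0 < j * v x) -> (forall x, 0 < v x * (C - v x)) ->
  is_lim v m_infty vm -> is_lim v p_infty vp ->
  (forall x, is_derive w x (q x)) ->
  (forall x, is_derive q x (w x + theta x ^ 4)) ->
  (forall x, Rabs (q x) <= B) -> (forall x, Rabs (w x) <= B) ->
  exists rho u e : R -> R,
    is_Ck (S k) rho /\ is_Ck (S k) u /\ is_Ck (S k) e /\
    radiating_gas_solution Rgas gamma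
      (traveling sigma rho) (traveling sigma u) (traveling sigma e) /\
    connects rho u e Um Up.
Proof.
  intros vm vp j q theta HR Hg Hvm Hvp Hj Hem Hep Hsum Hv Hjv HvC Hlm Hlp Hw Hq HqB HwB.
  set (rho := fun x => j * / v x).
  set (u := fun x => v x + sigma).
  set (e := fun x => / (gamma - 1) * (v x * (C + -1 * v x))).
  assert (Hv0 : forall x, v x <> 0).
  { intros x E; specialize (Hjv x); rewrite E in Hjv; lra. }
  assert (Hrho : Ck (S k) rho)
    by (apply Ck_mult; [apply Ck_const | now apply Ck_inv]).
  assert (Hu : Ck (S k) u) by (apply Ck_plus; [exact Hv | apply Ck_const]).
  assert (He : Ck (S k) e).
  { apply Ck_mult; [apply Ck_const|].
    apply Ck_mult; [exact Hv|]; apply Ck_plus; [apply Ck_const|].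
    apply Ck_mult; [apply Ck_const | exact Hv]. }
  assert (Htheta : forall x, temperature Rgas gamma (e x) = theta x).
  { intros x; unfold temperature, e, theta; field; lra. }
  assert (Hthc : forall x, continuous theta x).
  { intros x; apply (continuous_comp v (fun v => v * (C - v) / Rgas)).
    - apply (ex_derive_continuous v), Hv.
    - apply (ex_derive_continuous (fun v => v * (C - v) / Rgas)).
      auto_derive; trivial. }
  assert (Hflux : forall t x,
    flux_converges (fun x => temperature Rgas gamma (traveling sigma e t x)) x /\
    radiative_flux (fun x => temperature Rgas gamma (traveling sigma e t x)) x
      = q (x - sigma * t)).
  { intros t x; unfold traveling.
    assert (Hs : forall y, is_derive (fun y => y - sigma * t) y 1)
      by (intros; auto_derive; [trivial | ring]).
    apply (radiative_flux_of_balance _ (fun x => q (x - sigma * t))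
             (fun x => w (x - sigma * t)) B).
    - intros y; rewrite <- (Rmult_1_l (q _)).
      apply (is_derive_comp w (fun y => y - sigma * t)); [apply Hw | apply Hs].
    - intros y; rewrite Htheta, <- (Rmult_1_l (w _ + _)).
      apply (is_derive_comp q (fun y => y - sigma * t)); [apply Hq | apply Hs].
    - intros y; apply (continuous_ext (fun x => theta (x - sigma * t)));
        [intros; now rewrite Htheta|].
      apply (continuous_comp (fun y => y - sigma * t) theta);
        [exact (is_derive_continuous _ _ _ (Hs y)) | apply Hthc].
    - intros y; apply HqB.
    - intros y; apply HwB. }
  exists rho, u, e.
  split; [now apply Ck_is_Ck|]; split; [now apply Ck_is_Ck|].
  split; [now apply Ck_is_Ck|]; split.
  - split; [|split; [intros; apply Hflux | split; [|split]]].
    + intros t x; unfold traveling, rho, e.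
      set (y := x - sigma * t); specialize (Hjv y); specialize (HvC y); split.
      * replace (j * / v y) with (j * v y * (/ v y * / v y)) by (field; apply Hv0).
        apply Rmult_lt_0_compat; [exact Hjv|].
        apply Rsqr_pos_lt, Rinv_neq_0_compat, Hv0.
      * apply Rmult_lt_0_compat; [apply Rinv_0_lt_compat; lra|].
        replace (C + -1 * v y) with (C - v y) by ring; exact HvC.
    + apply (traveling_conservation sigma j rho).
      * apply Hrho.
      * intros t x; unfold traveling, rho, u; field; apply Hv0.
    + apply (traveling_conservation sigma (j * (sigma + C)) (fun x => rho x * u x)).
      * apply (Ck_mult (S k) rho u Hrho Hu).
      * intros t x; unfold traveling, rho, u, e, pressure; field.
        repeat split; try lra; apply Hv0.
    + apply (traveling_conservation sigma
        (j * (sigma ^ 2 / 2 + C * sigma + gamma * (vm * (C - vm)) / (gamma - 1) + vm ^ 2 / 2))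
        (fun x => rho x * total_energy (u x) (e x))).
      * apply (Ck_mult (S k) rho (fun x => total_energy (u x) (e x)) Hrho).
        apply Ck_plus; [exact He|]; apply Ck_mult; [|apply Ck_const].
        apply (Ck_mult (S k) u (fun x => u x * 1) Hu).
        now apply Ck_mult; [|apply Ck_const].
      * intros t x; rewrite (proj2 (Hflux t x)).
        unfold traveling, rho, u, e, q, total_energy, pressure.
        set (y := x - sigma * t).
        replace C with ((gamma + 1) * (vm + vp) / (2 * gamma))
          by (rewrite Hsum; field; lra).
        field; repeat split; try lra; apply Hv0.
  - assert (Hlim : forall (x : Rbar) (l : R) (U : state), l <> 0 ->
      dens U * l = j -> vel U - sigma = l -> (gamma - 1) * ener U = l * (C - l) ->
      is_lim v x l ->
      is_lim rho x (dens U) /\ is_lim u x (vel U) /\ is_lim e x (ener U)).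
    { intros x l U Hl Hd Hvel Hen Hx; repeat split.
      - replace (dens U) with (j * / l) by (rewrite <- Hd; field; exact Hl).
        apply (is_lim_comp_continuous v (fun v => j * / v) x l Hx).
        apply (ex_derive_continuous (fun v => j * / v)); auto_derive; exact Hl.
      - replace (vel U) with (l + sigma) by lra.
        apply (is_lim_comp_continuous v (fun v => v + sigma) x l Hx).
        apply (ex_derive_continuous (fun v => v + sigma)); auto_derive; trivial.
      - replace (ener U) with (/ (gamma - 1) * (l * (C + -1 * l))).
        + apply (is_lim_comp_continuous v
            (fun v => / (gamma - 1) * (v * (C + -1 * v))) x l Hx).
          apply (ex_derive_continuous (fun v => / (gamma - 1) * (v * (C + -1 * v)))).
          auto_derive; trivial.
        + apply (Rmult_eq_reg_l (gamma - 1)); [|lra].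
          rewrite Hen; field; lra. }
    split; [apply (Hlim m_infty vm) | apply (Hlim p_infty vp)]; trivial.
Qed.

(** * The velocity profile of a weak shock *)

(** A lower bound, valid near the sonic velocity [V >= V0], of the derivative of
    [theta^4 / a] along the profile, where [a <= A V]. *)
Definition source_slope_bound (Rgas gamma A V0 : R) : R :=
  4 / (Rgas * A) * (/ (4 * gamma * Rgas)) ^ 3 * ((gamma - 1) / (2 * gamma)) * V0 ^ 6.

Lemma source_slope_bound_pos (Rgas gamma A V0 : R) :
  0 < Rgas -> 1 < gamma -> 0 < A -> 0 < V0 -> 0 < source_slope_bound Rgas gamma A V0.
Proof.
  intros HR Hg HA HV; unfold source_slope_bound.
  apply Rmult_lt_0_compat; [apply Rmult_lt_0_compat; [apply Rmult_lt_0_compat|]|].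
  - apply Rdiv_lt_0_compat; nra.
  - apply pow_lt, Rinv_0_lt_compat; nra.
  - apply Rdiv_lt_0_compat; lra.
  - apply pow_lt; lra.
Qed.

(** The three factors of the slope are [V], [V / gamma] and [(1 - / gamma) V], up to
    constants, at the sonic velocity [z = 0]; the bound on [eps] keeps each of them
    above half of this value. *)
Lemma source_slope_bounds (Rgas gamma A V0 V eps a z : R) :
  let C := (gamma + 1) / gamma * V in
  let slope := 4 / (Rgas * a) * ((V - z) * (C - V + z) / Rgas) ^ 3 * (2 * V - C - 2 * z) in
  0 < Rgas -> 1 < gamma -> 0 < V0 <= V -> 0 < a <= A * V ->
  0 < eps <= (gamma - 1) / (4 * gamma ^ 2) * V -> - eps < z < eps ->
  source_slope_bound Rgas gamma A V0 <= slope <=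
  4 / (Rgas * a) * (4 * V ^ 2 / Rgas) ^ 3 * (2 * V).
Proof.
  intros C slope HR Hg HV Ha He Hz.
  assert (HA : 0 < A) by nra.
  assert (Hi : 0 < / gamma < 1)
    by (split; [apply Rinv_0_lt_compat | rewrite <- Rinv_1; apply Rinv_lt_contravar]; lra).
  set (i := / gamma) in *.
  assert (Hgi : (gamma - 1) / gamma = 1 - i) by (unfold i; field; lra).
  assert (HC : C - V = i * V) by (unfold C, i; field; lra).
  assert (Heta : (gamma - 1) / (4 * gamma ^ 2) = (1 - i) * i / 4)
    by (unfold i; field; lra).
  rewrite Heta in He.
  assert (He2 : eps <= i * V / 4 /\ eps <= (1 - i) * V / 4 /\ eps <= V / 4) by nra.
  assert (H1 : V / 2 <= V - z <= 2 * V) by lra.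
  assert (H2 : i * V / 2 <= C - V + z <= 2 * V) by (rewrite HC; nra).
  assert (H3 : (1 - i) * V / 2 <= 2 * V - C - 2 * z <= 2 * V).
  { replace (2 * V - C - 2 * z) with (V - (C - V) - 2 * z) by ring; rewrite HC; nra. }
  assert (HRi : 0 < / Rgas) by now apply Rinv_0_lt_compat.
  assert (H4 : V ^ 2 * (i / 4) / Rgas <= (V - z) * (C - V + z) / Rgas <= 4 * V ^ 2 / Rgas).
  { split; apply Rmult_le_compat_r; try lra; nra. }
  assert (H40 : 0 < V ^ 2 * (i / 4) / Rgas) by (apply Rdiv_lt_0_compat; nra).
  set (T := (V - z) * (C - V + z) / Rgas) in *.
  assert (H5 : (V ^ 2 * (i / 4) / Rgas) ^ 3 <= T ^ 3 <= (4 * V ^ 2 / Rgas) ^ 3)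
    by (split; apply pow_incr; lra).
  assert (H50 : 0 < (V ^ 2 * (i / 4) / Rgas) ^ 3) by now apply pow_lt.
  assert (Hca : 0 < 4 / (Rgas * a)) by (apply Rdiv_lt_0_compat; nra).
  unfold slope; split.
  - apply Rle_trans with
      (4 / (Rgas * (A * V)) * (V ^ 2 * (i / 4) / Rgas) ^ 3 * ((1 - i) * V / 2)).
    + replace (4 / (Rgas * (A * V)) * _ * _) with
        (4 / (Rgas * A) * (/ (4 * gamma * Rgas)) ^ 3 * ((gamma - 1) / (2 * gamma)) * V ^ 6)
        by (unfold i; field; repeat split; lra).
      unfold source_slope_bound.
      apply Rmult_le_compat_l; [|apply pow_incr; lra].
      apply Rmult_le_pos; [apply Rmult_le_pos|].
      * left; apply Rdiv_lt_0_compat; nra.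
      * left; apply pow_lt, Rinv_0_lt_compat; nra.
      * apply Rdiv_le_0_compat; lra.
    + apply Rmult_le_compat; [| nra | | apply H3].
      * apply Rmult_le_pos; [|lra].
        left; apply Rdiv_lt_0_compat; [lra|].
        apply Rmult_lt_0_compat; [exact HR | nra].
      * apply Rmult_le_compat; [| lra | | apply H5].
        -- left; apply Rdiv_lt_0_compat; [lra|].
           apply Rmult_lt_0_compat; [exact HR | nra].
        -- unfold Rdiv; apply Rmult_le_compat_l; [lra|].
           apply Rinv_le_contravar; [nra | apply Rmult_le_compat_l; lra].
  - apply Rmult_le_compat; [| nra | | apply H3].
    + apply Rmult_le_pos; lra.
    + apply Rmult_le_compat_l; lra.
Qed.

(** The profile between the velocities [V + eps] and [V - eps] on the two sides of
    the sonic velocity [V].  The pair [w], [q = a ((v - V)^2 - eps^2)] is a form of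
    [q'' - q = (theta^4)'] that needs no second derivative of [v]. *)
Lemma velocity_profile (Rgas gamma A V0 V eps a : R) (K : nat) :
  let C := (gamma + 1) / gamma * V in
  let m := source_slope_bound Rgas gamma A V0 in
  0 < Rgas -> 1 < gamma -> 0 < V0 <= V -> 0 < a <= A * V ->
  0 < eps <= (gamma - 1) / (4 * gamma ^ 2) * V ->
  eps ^ 2 <= m ^ 2 / 16 -> 4 * (INR K + 1) * eps ^ 2 < m ^ 2 ->
  exists v w : R -> R,
    Ck K v /\ (forall x, V - eps < v x < V + eps) /\
    is_lim v m_infty (V + eps) /\ is_lim v p_infty (V - eps) /\
    (forall x, is_derive w x (a * ((v x - V) ^ 2 - eps ^ 2))) /\
    (forall x, is_derive (fun x => a * ((v x - V) ^ 2 - eps ^ 2)) x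
                 (w x + (v x * (C - v x) / Rgas) ^ 4)) /\
    exists B, forall x, Rabs (a * ((v x - V) ^ 2 - eps ^ 2)) <= B /\ Rabs (w x) <= B.
Proof.
  intros C m HR Hg HV Ha He Hem HK.
  assert (Hm : 0 < m).
  { assert (0 < A) by nra; apply source_slope_bound_pos; lra. }
  set (phi := Mul (Const (4 / (Rgas * a)))
    (Mul (let T := Mul (Const (/ Rgas))
            (Mul (Add (Const V) (Mul (Const (-1)) (Jet 0))) (Add (Const (C - V)) (Jet 0)))
          in Mul T (Mul T T))
         (Add (Const (2 * V - C)) (Mul (Const (-2)) (Jet 0))))).
  set (phif := fun z : R => deval (fun _ => z) phi).
  assert (Hphif : forall z, phif z =
    4 / (Rgas * a) * ((V - z) * (C - V + z) / Rgas) ^ 3 * (2 * V - C - 2 * z)).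
  { intros z; unfold phif, phi; simpl; field; lra. }
  set (M := 4 / (Rgas * a) * (4 * V ^ 2 / Rgas) ^ 3 * (2 * V)).
  assert (Hb : forall z, - eps < z < eps -> m <= phif z <= M).
  { intros z Hz; rewrite Hphif.
    now apply (source_slope_bounds Rgas gamma A V0 V eps a z). }
  assert (HmM : 0 < m <= M) by (pose proof (Hb 0); lra).
  destruct (wave_profile eps m M phif) as (z & p & Hz0 & Hz & Hzd & Hpc & Hp & Hpd & Hlm & Hlp);
    trivial; [apply He | |].
  { intros z _; apply (continuous_ext (fun z =>
      4 / (Rgas * a) * ((V - z) * (C - V + z) / Rgas) ^ 3 * (2 * V - C - 2 * z)));
      [intros; now rewrite Hphif|].
    match goal with |- continuous ?f _ => apply (ex_derive_continuous f) end.
    auto_derive; trivial. }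
  assert (HCk : Ck K z).
  { apply (profile_smooth eps phi z p); trivial; [simpl; intuition lia | apply Hp |].
    fold (phif 0).
    assert (H0 : m <= phif 0) by (apply Hb; lra).
    apply Rlt_le_trans with (2 := H0).
    apply Rmult_lt_reg_r with m; [exact Hm|].
    assert (Hp0 : p 0 * m <= 2 * eps ^ 2).
    { apply Rle_trans with (2 * eps ^ 2 / m * m);
        [apply Rmult_le_compat_r; [lra | apply Hp] | right; field; lra]. }
    pose proof (pos_INR K); nra. }
  set (theta := fun x => (V - z x) * (C - V + z x) / Rgas).
  set (w := fun x => a * (2 * z x * p x) - theta x ^ 4).
  assert (Hth : forall x, is_derive (fun x => theta x ^ 4) x (a * phif (z x) * p x)).
  { intros x; rewrite Hphif; unfold theta; auto_derive.
    - repeat split; exists (p x); apply Hzd.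
    - replace (Derive (fun x => z x) x) with (p x)
        by (symmetry; apply is_derive_unique, Hzd).
      simpl; field; lra. }
  assert (Hzc : forall x, continuous z x)
    by (intros x; exact (is_derive_continuous _ _ _ (Hzd x))).
  assert (Hwd : forall x, is_derive w x (a * (z x ^ 2 - eps ^ 2))).
  { assert (Hoff : forall x, x <> 0 -> is_derive w x (a * (z x ^ 2 - eps ^ 2))).
    { intros x Hx; destruct (Hpd x Hx) as [Hzx Hpx].
      set (dp := (z x ^ 2 - eps ^ 2 + phif (z x) * p x - 2 * p x ^ 2) / (2 * z x)).
      replace (a * (z x ^ 2 - eps ^ 2)) with
        (a * (2 * p x * p x + 2 * z x * dp) - a * phif (z x) * p x)
        by (unfold dp; field; exact Hzx).
      apply (is_derive_minus (fun x => a * (2 * z x * p x)) (fun x => theta x ^ 4));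
        [|apply Hth].
      apply (is_derive_scal (fun x => 2 * z x * p x)).
      apply (is_derive_mult (fun x => 2 * z x) p);
        [apply (is_derive_scal z), Hzd | exact Hpx | intros; apply Rmult_comm]. }
    intros x; destruct (Req_dec x 0) as [->|Hx]; [|now apply Hoff].
    apply (derivative_extends w (fun x => a * (z x ^ 2 - eps ^ 2))); [| exact Hoff |].
    - unfold w; apply continuous_minus_R; [|exact (is_derive_continuous _ _ _ (Hth 0))].
      repeat apply continuous_mult_R; try apply continuous_const; trivial.
    - apply (continuous_is_lim_0 (fun x => a * (z x ^ 2 - eps ^ 2))).
      apply (continuous_comp z (fun z => a * (z ^ 2 - eps ^ 2))); [apply Hzc|].
      apply (ex_derive_continuous (fun z => a * (z ^ 2 - eps ^ 2))); auto_derive; trivial. }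
  exists (fun x => V + -1 * z x), w.
  split; [|split; [|split; [|split; [|split; [|split]]]]].
  - apply Ck_plus; [apply Ck_const | apply Ck_mult; [apply Ck_const | exact HCk]].
  - intros x; specialize (Hz x); lra.
  - replace (V + eps) with (V + -1 * - eps) by ring.
    apply (is_lim_comp_continuous z (fun z => V + -1 * z) m_infty (- eps) Hlm).
    apply (ex_derive_continuous (fun z => V + -1 * z)); auto_derive; trivial.
  - replace (V - eps) with (V + -1 * eps) by ring.
    apply (is_lim_comp_continuous z (fun z => V + -1 * z) p_infty eps Hlp).
    apply (ex_derive_continuous (fun z => V + -1 * z)); auto_derive; trivial.
  - intros x; replace (V + -1 * z x - V) with (- z x) by ring.
    replace ((- z x) ^ 2) with (z x ^ 2) by ring; apply Hwd.
  - intros x; unfold w, theta; auto_derive; [exists (p x); apply Hzd|].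
    replace (Derive (fun x => z x) x) with (p x)
      by (symmetry; apply is_derive_unique, Hzd).
    simpl; field; lra.
  - set (S4 := (4 * V ^ 2 / Rgas) ^ 4).
    exists (a * eps ^ 2 + a * (4 * eps ^ 3 / m) + S4); intros x.
    specialize (Hz x); specialize (Hp x).
    assert (Heps : 0 <= eps ^ 3) by (apply pow_le; lra).
    assert (HS4 : 0 <= S4).
    { apply pow_le, Rdiv_le_0_compat; [|exact HR]; nra. }
    assert (Hae : 0 <= a * (4 * eps ^ 3 / m))
      by (apply Rmult_le_pos; [lra | apply Rdiv_le_0_compat; lra]).
    assert (HeV : eps <= V).
    { assert ((gamma - 1) / (4 * gamma ^ 2) <= 1); [|nra].
      apply Rle_div_l; nra. }
    split.
    + replace (V + -1 * z x - V) with (- z x) by ring.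
      assert (0 <= (- z x) ^ 2 <= eps ^ 2) by (split; nra).
      assert (0 <= a * (- z x) ^ 2 <= a * eps ^ 2)
        by (split; [apply Rmult_le_pos | apply Rmult_le_compat_l]; lra).
      apply Rabs_le; lra.
    + assert (Hzp : - (4 * eps ^ 3 / m) <= 2 * z x * p x <= 4 * eps ^ 3 / m).
      { replace (4 * eps ^ 3 / m) with (2 * eps * (2 * eps ^ 2 / m)) by (field; lra).
        assert (0 <= 2 * (eps - z x) * p x) by (apply Rmult_le_pos; lra).
        assert (0 <= 2 * (eps + z x) * p x) by (apply Rmult_le_pos; lra).
        assert (2 * eps * p x <= 2 * eps * (2 * eps ^ 2 / m))
          by (apply Rmult_le_compat_l; lra).
        lra. }
      assert (0 <= a * (2 * z x * p x + 4 * eps ^ 3 / m) /\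
              0 <= a * (4 * eps ^ 3 / m - 2 * z x * p x))
        by (split; apply Rmult_le_pos; lra).
      assert (0 <= a * eps ^ 2) by (apply Rmult_le_pos; [lra | apply pow2_ge_0]).
      assert (Hth0 : 0 <= theta x ^ 4 <= S4).
      { assert (HCV : C - V = / gamma * V) by (unfold C; field; lra).
        assert (HCz : 0 <= C - V + z x <= 2 * V).
        { assert (0 < / gamma < 1)
            by (split; [apply Rinv_0_lt_compat | rewrite <- Rinv_1; apply Rinv_lt_contravar]; lra).
          assert (Heta : (gamma - 1) / (4 * gamma ^ 2) = (1 - / gamma) * / gamma / 4)
            by (field; lra).
          rewrite Heta in He; rewrite HCV; set (i := / gamma) in *.
          assert (0 < i * V) by (apply Rmult_lt_0_compat; lra).
          assert ((1 - i) * (i * V) <= i * V <= V) by nra; lra. }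
        assert (Ht : 0 <= theta x <= 4 * V ^ 2 / Rgas).
        { assert (0 < / Rgas) by now apply Rinv_0_lt_compat.
          unfold theta, Rdiv; split; [apply Rmult_le_pos; [nra|lra]|].
          apply Rmult_le_compat_r; [lra | nra]. }
        split; [apply pow_le; lra | apply pow_incr; lra]. }
      unfold w; apply Rabs_le; lra.
Qed.

(** * Weak shocks *)

Lemma sound_speed_sqr (gamma e : R) :
  1 < gamma -> 0 < e -> sound_speed gamma e ^ 2 = gamma * (gamma - 1) * e.
Proof.
  intros Hg He; unfold sound_speed; rewrite <- Rsqr_pow2; apply Rsqr_sqrt.
  apply Rmult_le_pos; nra.
Qed.

(** Excludes equal relative velocities across a shock: the sound speeds would agree,
    against the Lax inequalities. *)
Lemma rankine_hugoniot_contact (gamma sigma : R) (Um Up : state) :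
  1 < gamma -> 0 < dens Um -> vel Um - sigma <> 0 -> vel Up - sigma = vel Um - sigma ->
  rankine_hugoniot gamma sigma Um Up -> ener Up = ener Um.
Proof.
  intros Hg Hr Hv Hvel (H1 & H2 & _); unfold pressure in *; rewrite Hvel in *.
  apply Rmult_eq_reg_r in H1; [|exact Hv]; rewrite H1 in H2.
  apply (Rmult_eq_reg_l ((gamma - 1) * dens Um)); [lra|].
  apply Rgt_not_eq; nra.
Qed.

(** The sonic velocity [V] is the mean of the relative velocities at the end
    states, and is bounded from below because one end state is supersonic.  A
    3-shock is the mirror image of a 1-shock: [x] and [v] change sign. *)
Lemma weak_shock_traveling_wave (Rgas gamma sigma V0 : R) (k : nat) (Um Up : state) :
  let eps := Rabs (vel Up - vel Um) / 2 in
  let m := source_slope_bound Rgas gamma (dens Um * ((gamma + 1) / (gamma - 1))) V0 in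
  0 < Rgas -> 1 < gamma -> admissible Um -> admissible Up ->
  shock_wave gamma sigma Um Up -> 0 < V0 ->
  2 * V0 <= sound_speed gamma (ener Um) -> 2 * V0 <= sound_speed gamma (ener Up) ->
  eps <= V0 -> eps <= (gamma - 1) / (4 * gamma ^ 2) * V0 ->
  eps ^ 2 <= m ^ 2 / 16 -> 4 * (INR (S k) + 1) * eps ^ 2 < m ^ 2 ->
  exists rho u e : R -> R,
    is_Ck (S k) rho /\ is_Ck (S k) u /\ is_Ck (S k) e /\
    radiating_gas_solution Rgas gamma
      (traveling sigma rho) (traveling sigma u) (traveling sigma e) /\
    connects rho u e Um Up.
Proof.
  intros eps m HR Hg [Hrm Hem] [Hrp Hep] [HRH Hlax] HV0 Hcm Hcp HeV Heta Hem2 HK.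
  set (vm := vel Um - sigma); set (vp := vel Up - sigma).
  set (cm := sound_speed gamma (ener Um)) in *.
  set (cp := sound_speed gamma (ener Up)) in *.
  assert (Hcm2 : cm ^ 2 = gamma * (gamma - 1) * ener Um) by now apply sound_speed_sqr.
  assert (Hcp2 : cp ^ 2 = gamma * (gamma - 1) * ener Up) by now apply sound_speed_sqr.
  assert (Hlax' : (cm < vm /\ 0 < vp < cp) \/ (- cm < vm < 0 /\ vp < - cp)).
  { unfold vm, vp; destruct Hlax as [[H1 H2]|[H1 H2]]; fold cm cp in H1, H2; lra. }
  assert (Hvm : vm <> 0) by lra. assert (Hvp : vp <> 0) by lra.
  assert (Hne : vp <> vm).
  { intros E; pose proof (rankine_hugoniot_contact gamma sigma Um Up Hg Hrm Hvm E HRH) as Ee.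
    unfold cp in Hlax'; rewrite Ee in Hlax'; fold cm in Hlax'; lra. }
  destruct (rankine_hugoniot_relative gamma sigma Um Up Hrm HRH Hvm Hvp Hne)
    as (C & Hj & HCm & HCp & Hsum); fold vm vp in Hj, HCm, HCp, Hsum.
  assert (Hgm : cm ^ 2 = gamma * (vm * (C - vm))) by (rewrite Hcm2, <- HCm; ring).
  assert (Hgp : cp ^ 2 = gamma * (vp * (C - vp))) by (rewrite Hcp2, <- HCp; ring).
  set (A := dens Um * ((gamma + 1) / (gamma - 1))) in *.
  set (kappa := (gamma + 1) / (2 * (gamma - 1))).
  assert (Hkappa : 0 < kappa) by (apply Rdiv_lt_0_compat; lra).
  assert (HA : A = 2 * (dens Um * kappa)) by (unfold A, kappa; field; lra).
  assert (Hrk : 0 < dens Um * kappa) by now apply Rmult_lt_0_compat.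
  assert (Heta0 : 0 < (gamma - 1) / (4 * gamma ^ 2)) by (apply Rdiv_lt_0_compat; nra).
  assert (Hi : 0 < / gamma) by (apply Rinv_0_lt_compat; lra).
  assert (HetaV : forall V, V0 <= V -> eps <= (gamma - 1) / (4 * gamma ^ 2) * V).
  { intros V HV; apply Rle_trans with (1 := Heta); apply Rmult_le_compat_l; lra. }
  assert (Hetai : forall V, 0 < V -> (gamma - 1) / (4 * gamma ^ 2) * V < / gamma * V).
  { intros V HV; apply Rmult_lt_compat_r; [exact HV|].
    apply Rlt_div_l; [nra|]; replace (/ gamma * (4 * gamma ^ 2)) with (4 * gamma)
      by (field; lra); lra. }
  destruct Hlax' as [[H1 H2]|[H1 H2]].
  -
    (* across the shock [(gamma + 1) v - gamma C] changes from positive to negative *)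
    assert (Hord : vp < vm).
    { assert (gamma * C < (gamma + 1) * vm).
      { apply Rmult_lt_reg_r with vm; [lra|]; nra. }
      assert ((gamma + 1) * vp < gamma * C).
      { apply Rmult_lt_reg_r with vp; [lra|]; nra. }
      nra. }
    assert (Heps : eps = (vm - vp) / 2).
    { unfold eps; rewrite Rabs_left1; [unfold vm, vp; field | unfold vm, vp in *; lra]. }
    set (V := (vm + vp) / 2).
    assert (HCV : C = (gamma + 1) / gamma * V).
    { apply (Rmult_eq_reg_l (2 * gamma)); [|lra].
      rewrite <- Hsum; unfold V; field; lra. }
    assert (HV : V0 <= V) by (unfold V; lra).
    assert (Hvm' : vm = V + eps) by (rewrite Heps; unfold V; field).
    assert (Hvp' : vp = V - eps) by (rewrite Heps; unfold V; field).
    destruct (velocity_profile Rgas gamma A V0 V eps (dens Um * kappa * vm) (S k))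
      as (v & w & Hv & Hvb & Hlm & Hlp & Hw & Hq & B & HB); trivial; try lra.
    { split; [apply Rmult_lt_0_compat; lra|].
      rewrite HA; replace (2 * (dens Um * kappa) * V) with (dens Um * kappa * (2 * V)) by ring.
      apply Rmult_le_compat_l; lra. }
    { split; [lra | now apply HetaV]. }
    rewrite <- HCV in Hq.
    assert (HCv : forall x, 0 < C - v x).
    { intros x; replace (C - v x) with (/ gamma * V - (v x - V))
        by (rewrite HCV; field; lra).
      pose proof (Hvb x); pose proof (Hetai V); pose proof (HetaV V HV); lra. }
    assert (Hqeq : forall x, dens Um * kappa * vm * ((v x - V) ^ 2 - eps ^ 2) =
      dens Um * vm * (gamma + 1) / (2 * (gamma - 1)) * ((v x - vm) * (v x - vp))).
    { intros x; unfold kappa; rewrite Hvp', Hvm'; field; lra. }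
    apply (traveling_wave_of_velocity Rgas gamma sigma C B k Um Up v w);
      fold vm vp; trivial.
    + intros x; pose proof (Hvb x).
      apply Rmult_lt_0_compat; [apply Rmult_lt_0_compat|]; lra.
    + intros x; pose proof (Hvb x); apply Rmult_lt_0_compat; [lra | apply HCv].
    + now rewrite Hvm'.
    + now rewrite Hvp'.
    + intros x; rewrite <- Hqeq; apply Hw.
    + intros x; apply (is_derive_ext _ _ x _ Hqeq), Hq.
    + intros x; rewrite <- Hqeq; apply HB.
    + intros x; apply HB.
  - assert (Hord : vp < vm).
    { assert ((gamma + 1) * vp < gamma * C).
      { apply Rmult_lt_reg_r with (- vp); [lra|]; nra. }
      assert (gamma * C < (gamma + 1) * vm).
      { apply Rmult_lt_reg_r with (- vm); [lra|]; nra. }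
      nra. }
    assert (Heps : eps = (vm - vp) / 2).
    { unfold eps; rewrite Rabs_left1; [unfold vm, vp; field | unfold vm, vp in *; lra]. }
    set (V := - (vm + vp) / 2).
    assert (HCV : - C = (gamma + 1) / gamma * V).
    { apply (Rmult_eq_reg_l (- (2 * gamma))); [|lra].
      replace (- (2 * gamma) * - C) with (2 * gamma * C) by ring.
      rewrite <- Hsum; unfold V; field; lra. }
    assert (HV : V0 <= V) by (unfold V; lra).
    assert (Hvm' : vm = - (V - eps)) by (rewrite Heps; unfold V; field).
    assert (Hvp' : vp = - (V + eps)) by (rewrite Heps; unfold V; field).
    destruct (velocity_profile Rgas gamma A V0 V eps (dens Um * kappa * - vm) (S k))
      as (v & w & Hv & Hvb & Hlm & Hlp & Hw & Hq & B & HB); trivial; try lra.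
    { split; [apply Rmult_lt_0_compat; lra|].
      rewrite HA; replace (2 * (dens Um * kappa) * V) with (dens Um * kappa * (2 * V)) by ring.
      apply Rmult_le_compat_l; lra. }
    { split; [lra | now apply HetaV]. }
    rewrite <- HCV in Hq.
    assert (HCv : forall x, 0 < - C - v x).
    { intros x; replace (- C - v x) with (/ gamma * V - (v x - V))
        by (rewrite HCV; field; lra).
      pose proof (Hvb x); pose proof (Hetai V); pose proof (HetaV V HV); lra. }
    assert (Hopp : forall x, is_derive (fun y : R => - y) x (-1))
      by (intros; auto_derive; [trivial | ring]).
    assert (Hqeq : forall x,
      -1 * (dens Um * kappa * - vm * ((v (- x) - V) ^ 2 - eps ^ 2)) =
      dens Um * vm * (gamma + 1) / (2 * (gamma - 1)) *
        ((-1 * v (- x) - vm) * (-1 * v (- x) - vp))).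
    { intros x; unfold kappa; rewrite Hvp', Hvm'; field; lra. }
    apply (traveling_wave_of_velocity Rgas gamma sigma C B k Um Up
             (fun x => -1 * v (- x)) (fun x => w (- x))); fold vm vp; trivial.
    + apply Ck_mult; [apply Ck_const | now apply Ck_comp_opp].
    + intros x; pose proof (Hvb (- x)).
      replace (dens Um * vm * (-1 * v (- x))) with (dens Um * - vm * v (- x)) by ring.
      apply Rmult_lt_0_compat; [apply Rmult_lt_0_compat|]; lra.
    + intros x; pose proof (Hvb (- x)); pose proof (HCv (- x)).
      replace (-1 * v (- x) * (C - -1 * v (- x))) with (v (- x) * (- C - v (- x))) by ring.
      apply Rmult_lt_0_compat; lra.
    + replace vm with (-1 * (V - eps)) by lra.
      apply (is_lim_scal_l (fun x => v (- x)) (-1) m_infty (V - eps)).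
      apply (is_lim_comp v (fun x => - x) m_infty (V - eps) p_infty); [exact Hlp | |].
      * apply (is_lim_opp (fun x => x) m_infty m_infty), is_lim_id.
      * exists 0; intros; discriminate.
    + replace vp with (-1 * (V + eps)) by lra.
      apply (is_lim_scal_l (fun x => v (- x)) (-1) p_infty (V + eps)).
      apply (is_lim_comp v (fun x => - x) p_infty (V + eps) m_infty); [exact Hlm | |].
      * apply (is_lim_opp (fun x => x) p_infty p_infty), is_lim_id.
      * exists 0; intros; discriminate.
    + intros x; rewrite <- Hqeq.
      apply (is_derive_comp w (fun x => - x)); [apply Hw | apply Hopp].
    + intros x; apply (is_derive_ext _ _ x _ Hqeq).
      match goal with |- is_derive _ _ ?l =>
        replace l with (-1 * (-1 * (w (- x) + (v (- x) * (- C - v (- x)) / Rgas) ^ 4))) end.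
      * apply (is_derive_scal
          (fun x => dens Um * kappa * - vm * ((v (- x) - V) ^ 2 - eps ^ 2))).
        apply (is_derive_comp (fun x => dens Um * kappa * - vm * ((v x - V) ^ 2 - eps ^ 2))
                 (fun x => - x)); [apply Hq | apply Hopp].
      * field; lra.
    + intros x; rewrite <- Hqeq, Rabs_mult, Rabs_m1, Rmult_1_l; apply HB.
    + intros x; apply HB.
Qed.

Lemma state_distance (Um Up : state) (d : R) :
  norm (minus (Up : R * R * R) Um) <= d ->
  Rabs (vel Up - vel Um) <= d /\ Rabs (ener Up - ener Um) <= d.
Proof.
  intros H; split.
  - apply Rle_trans with (2 := H).
    apply Rle_trans with (norm (fst (minus (Up : R * R * R) Um)));
      [apply (norm_le_prod_norm_2 (fst (minus (Up : R * R * R) Um)))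
      | apply (norm_le_prod_norm_1 (minus (Up : R * R * R) Um))].
  - apply Rle_trans with (2 := H).
    apply (norm_le_prod_norm_2 (minus (Up : R * R * R) Um)).
Qed.

Theorem theorem2 (Rgas gamma : R) (hRgas : 0 < Rgas)
  (hgamma : 1 < gamma < (sqrt 7 + 1) / (sqrt 7 - 1))
  (Um : state) (hUm : admissible Um) :
  exists delta : nat -> R,
    (forall n : nat, 0 < delta n) /\
    (forall n : nat, delta (S n) < delta n) /\
    forall (n : nat) (Up : state) (sigma : R),
      admissible Up ->
      norm (minus (Up : R * R * R) Um) <= delta n ->
      shock_wave gamma sigma Um Up ->
      exists rho u e : R -> R,
        is_Ck (n + 2) rho /\ is_Ck (n + 2) u /\ is_Ck (n + 2) e /\
        radiating_gas_solution Rgas gamma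
          (traveling sigma rho) (traveling sigma u) (traveling sigma e) /\
        connects rho u e Um Up.
Proof.
  assert (Hg : 1 < gamma) by apply hgamma.
  destruct (hUm) as [Hrm Hem].
  (* once [ener Up >= ener Um / 2], both sound speeds are at least [2 V0], and the
     sonic velocity is at least [V0] *)
  set (V0 := sound_speed gamma (ener Um / 2) / 2).
  assert (HV0 : 0 < V0).
  { apply Rdiv_lt_0_compat; [|lra]; apply sqrt_lt_R0.
    repeat apply Rmult_lt_0_compat; lra. }
  set (m := source_slope_bound Rgas gamma (dens Um * ((gamma + 1) / (gamma - 1))) V0).
  assert (Hm : 0 < m).
  { assert (0 < (gamma + 1) / (gamma - 1)) by (apply Rdiv_lt_0_compat; lra).
    apply source_slope_bound_pos; trivial; nra. }
  set (eta := (gamma - 1) / (4 * gamma ^ 2)).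
  assert (Heta : 0 < eta) by (apply Rdiv_lt_0_compat; nra).
  set (d := Rmin (ener Um / 2) (Rmin (Rmin V0 (eta * V0)) (m / 4))).
  assert (Hd : 0 < d /\ d <= ener Um / 2 /\ d <= V0 /\ d <= eta * V0 /\ d <= m / 4).
  { unfold d.
    pose proof (Rmin_l (ener Um / 2) (Rmin (Rmin V0 (eta * V0)) (m / 4))).
    pose proof (Rmin_r (ener Um / 2) (Rmin (Rmin V0 (eta * V0)) (m / 4))).
    pose proof (Rmin_l (Rmin V0 (eta * V0)) (m / 4)).
    pose proof (Rmin_r (Rmin V0 (eta * V0)) (m / 4)).
    pose proof (Rmin_l V0 (eta * V0)); pose proof (Rmin_r V0 (eta * V0)).
    split; [repeat apply Rmin_glb_lt; nra | lra]. }
  assert (Hn : forall n, 1 <= INR (S n)) by (intros n; rewrite S_INR; pose proof (pos_INR n); lra).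
  (* the [n]-th smallness condition reads [4 (n + 3) eps^2 < m^2] *)
  exists (fun n => d / INR (S n)); split; [|split].
  - intros n; pose proof (Hn n); apply Rdiv_lt_0_compat; lra.
  - intros n; pose proof (Hn n).
    apply Rmult_lt_compat_l; [lra|]; apply Rinv_lt_contravar;
      [|rewrite (S_INR (S n)); lra].
    pose proof (Hn (S n)); nra.
  - intros n Up sigma HUp Hdist Hshock.
    apply state_distance in Hdist; destruct Hdist as [Hvel Hen].
    set (N := INR (S n)) in *; pose proof (Hn n) as HN; fold N in HN.
    assert (HdN : d / N * N = d) by (field; lra).
    assert (HdN0 : 0 < d / N) by (apply Rdiv_lt_0_compat; lra).
    assert (HdNd : d / N <= d) by nra.
    set (eps := Rabs (vel Up - vel Um) / 2).
    assert (Heps : 0 <= eps) by (pose proof (Rabs_pos (vel Up - vel Um)); unfold eps; lra).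
    assert (HepsN : eps * N <= m / 8) by (unfold eps; nra).
    assert (Hsound : forall e, ener Um / 2 <= e -> 2 * V0 <= sound_speed gamma e).
    { intros e He; replace (2 * V0) with (sound_speed gamma (ener Um / 2))
        by (unfold V0; field).
      apply sqrt_le_1_alt, Rmult_le_compat_l; [nra | exact He]. }
    apply Rabs_le_between in Hen.
    replace (n + 2)%nat with (S (S n)) by lia.
    apply (weak_shock_traveling_wave Rgas gamma sigma V0 (S n) Um Up); fold eps; fold m;
      trivial; try (apply Hsound; lra).
    + unfold eps; lra.
    + fold eta; unfold eps; lra.
    + assert (eps <= m / 8) by nra; nra.
    + rewrite S_INR; fold N.
      assert (Hsq : (eps * N) ^ 2 <= (m / 8) ^ 2).
      { apply pow_incr; split; [apply Rmult_le_pos; lra | exact HepsN]. }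
      assert (N + 2 <= 3 * N ^ 2) by nra.
      assert (4 * (N + 2) * eps ^ 2 <= 12 * (eps * N) ^ 2); [|nra].
      replace (12 * (eps * N) ^ 2) with (4 * (3 * N ^ 2) * eps ^ 2) by ring.
      apply Rmult_le_compat_r; [apply pow2_ge_0 | lra].
Qed.
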